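(* Let $n\ge1$ and let $\mathbf P=(\Delta_{[i,j]})_{1\le i\le j\le n}$ with variables $\mathbf x=(x_{ij})_{1\le i\le j\le n}$. Up to a sign, the dual mixed volume $\tilde m_{\mathbf P}(\mathbf x)|_{\langle\mathbf x,\mathbf 1\rangle=0}$ of the associahedron is equal to the planar $\phi^3$-amplitude $\mathcal A^{\phi^3}_{n+2}$ under the substitution $x_{ij}\mapsto s_{i,j+1}$ ($1\le i\le j\le n$).
   Context: $\Delta_{[i,j]}=\mathrm{conv}(\mathbf e_i,\dots,\mathbf e_j)\subset\mathbb{R}^n$; the associahedron is $\sum_{1\le i\le j\le n}x_{ij}\Delta_{[i,j]}$. Planar $\phi^3$-amplitude for $N$ particles: Mandelstam variables $s_{ij}$ ($i,j\in\{1,\dots,N\}$) satisfy $s_{ii}=0$, $s_{ij}=s_{ji}$, and $\sum_j s_{ij}=0$ for each $i$ (and are otherwise free). $\mathcal{PC}(N)$ is the set of planar cubic trees with $N$ leaves: planar trees drawn in a disk with $N$ boundary vertices labelled $1,\dots,N$ counterclockwise, each of degree 1, and all interior vertices of degree 3 (up to isotopy). Then $$\mathcal A^{\phi^3}_N=\sum_{T\in\mathcal{PC}(N)}\ \prod_{e\in E(T)}\frac1{X_e},$$ where $E(T)$ is the set of interior edges (edges joining two interior vertices) and $X_e=\sum_{a\le i<j\le b-1}s_{ij}$ (sum over unordered pairs of leaves), where one of the connected components of $T\setminus e$ contains exactly the leaves $a,a+1,\dots,b-1$ (considered cyclically); the value does not depend on which component is used. Under the substitution, the condition $\sum x_{ij}=0$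 becomes $\sum_{1\le i<j\le n+1}s_{ij}=0$, which holds automatically for $N=n+2$. Hyperplane dual mixed volume: let $\mathbf P=(P_1,\dots,P_r)$ be polytopes in $\{\mathbf y\in\mathbb{R}^n:\sum y_i=1\}$ whose Minkowski sum $P$ has dimension $n-1$. Let $\mathrm{cone}(P)=\{t\mathbf y:\mathbf y\in P,t\ge0\}$ and $\mathrm{cone}(P)^*=\{\mathbf v:\langle\mathbf v,\mathbf y\rangle\ge0\ \forall\mathbf y\in\mathrm{cone}(P)\}$. With $h_{P_i}(\mathbf v)=-\min_{\mathbf y\in P_i}\langle\mathbf v,\mathbf y\rangle$ and $\mathcal T$ a triangulation of the boundary of $\mathrm{cone}(P)^*$ into $(n-1)$-dimensional simplicial cones, $$\tilde m_{\mathbf P}(\mathbf x,\mathbf z)=\sum_{F=\mathrm{span}_{\ge0}(\mathbf v_1,\dots,\mathbf v_{n-1})\in\mathcal T}\frac{|\det(\mathbf v_1,\dots,\mathbf v_{n-1},\mathbf 1)|}{\prod_{k=1}^{n-1}\bigl(\sum_{i}x_ih_{P_i}(\mathbf v_k)+\langle\mathbf v_k,\mathbf z\rangle\bigr)},\qquad\mathbf 1=(1,\dots,1),$$ (independent of $\mathcal T$). $\tilde m_{\mathbf P}(\mathbf x)$ means $\tilde m_{\mathbf P}(\mathbf x,\mathbf 0)$, and $|_{\langle\mathbf x,\mathbf 1\rangle=0}$ denotes restriction to the hyperplane where the sum of all variables $\mathbf x$ is zero. *)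

(* Defs.v *)
From HB Require Import structures.
From mathcomp Require Import all_boot all_order all_algebra all_fingroup.
From mathcomp Require Import all_classical all_reals all_analysis.
Set Implicit Arguments.
Unset Strict Implicit.
Unset Printing Implicit Defensive.
Import Order.TTheory GRing.Theory Num.Theory.
Import numFieldNormedType.Exports.
Local Open Scope classical_set_scope.
Local Open Scope ring_scope.

Section Polyhedra.
Context {R : realType} {n : nat}.
Implicit Types (v y : 'rV[R]_n) (A : set 'rV[R]_n).

Definition dot v y : R := \sum_(k < n) v 0 k * y 0 k.

Definition span_ge0 (I : finType) (J : {set I}) (w : I -> 'rV[R]_n) :
    set 'rV[R]_n :=
  [set y | exists c : I -> R,
     (forall i, 0 <= c i) /\ y = \sum_(i in J) c i *: w i].

Definition conv_hull (I : finType) (J : {set I}) (w : I -> 'rV[R]_n) :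
    set 'rV[R]_n :=
  [set y | exists c : I -> R,
     [/\ forall i, 0 <= c i, \sum_(i in J) c i = 1
       & y = \sum_(i in J) c i *: w i]].

Definition minkowski_sum (I : finType) (P : I -> set 'rV[R]_n) :
    set 'rV[R]_n :=
  [set y | exists p : I -> 'rV[R]_n,
     (forall i, P i (p i)) /\ y = \sum_i p i].

Definition cone A : set 'rV[R]_n :=
  [set u | exists t y, [/\ 0 <= t, A y & u = t *: y]].

Definition dual_cone A : set 'rV[R]_n :=
  [set v | forall y, A y -> 0 <= dot v y].

Definition boundary A : set 'rV[R]_n := closure A `\` interior A.

(* The infimum is attained when A is a polytope. *)
Definition hfun A v : R := - inf [set dot v y | y in A].

(** A simplicial cone of dimension n - 1 is given by its n - 1 generators;
    its faces are the cones spanned by subfamilies of the generators. *)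

Definition face (F : n.-1.-tuple 'rV[R]_n) (J : {set 'I_n.-1}) :=
  span_ge0 J (tnth F).

Definition scone (F : n.-1.-tuple 'rV[R]_n) := face F [set: 'I_n.-1].

Definition is_triangulation (m : nat) (T : 'I_m -> n.-1.-tuple 'rV[R]_n) A :=
  [/\ forall a, free (T a),
      \bigcup_a scone (T a) = A
    & forall a b, a != b ->
        scone (T a) <> scone (T b) /\
        exists J K : {set 'I_n.-1},
          scone (T a) `&` scone (T b) = face (T a) J /\
          face (T a) J = face (T b) K].

End Polyhedra.

Section DualMixedVolume.
Context {R : realType} {n : nat} {I : finType}.
Variables (P : I -> set 'rV[R]_n).

(* For n > 0, the default value of [nth] fills exactly the last row, so the
   rows are v_1, ..., v_(n-1), (1, ..., 1). *)
Definition gens_mx (F : n.-1.-tuple 'rV[R]_n) : 'M[R]_n :=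
  \matrix_(i < n) nth (const_mx 1) F i.

Definition dmv_denom (x : I -> R) (z v : 'rV[R]_n) : R :=
  \sum_i x i * hfun (P i) v + dot v z.

Definition dual_mixed_volume (m : nat) (T : 'I_m -> n.-1.-tuple 'rV[R]_n)
    (x : I -> R) (z : 'rV[R]_n) : R :=
  \sum_(a < m) `|\det (gens_mx (T a))|
               / \prod_(k < n.-1) dmv_denom x z (tnth (T a) k).

Definition dmv_triangulation (m : nat) (T : 'I_m -> n.-1.-tuple 'rV[R]_n) :=
  is_triangulation T (boundary (dual_cone (cone (minkowski_sum P)))).

(* Rational functions are compared at the points where no denominator
   vanishes. *)
Definition dmv_regular (m : nat) (T : 'I_m -> n.-1.-tuple 'rV[R]_n)
    (x : I -> R) (z : 'rV[R]_n) :=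
  forall a k, dmv_denom x z (tnth (T a) k) != 0.

End DualMixedVolume.

(* The pairs i <= j, with indices starting at 0. *)
Definition index_pair (n : nat) : finType :=
  {p : 'I_n * 'I_n | (p.1 <= p.2)%N}.

Definition Delta {R : realType} {n : nat} (p : index_pair n) : set 'rV[R]_n :=
  conv_hull [set k : 'I_n | ((val p).1 <= k <= (val p).2)%N]
            (fun k => delta_mx 0 k).

(** A planar tree in a disk is represented, up to isotopy, by its graph
    together with the counterclockwise cyclic order of the neighbours of each
    vertex (a rotation system).  The vertices are the N leaves [inl i] and the
    interior vertices [inr v]; a cubic tree with N leaves has exactly N - 2
    interior vertices, and the names of these are immaterial. *)

Definition vertex (N : nat) : finType := ('I_N + 'I_N.-2)%type.

Definition ptree (N : nat) : finType :=
  ({set vertex N * vertex N} * {ffun vertex N * vertex N -> vertex N})%type.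

Section Trees.
Context {N : nat}.
Implicit Types (t : ptree N) (u v w : vertex N) (e : {set vertex N}).

Definition adj t : rel (vertex N) := fun u v => (u, v) \in t.1.

(* The neighbour of v that follows u counterclockwise around v; only
   meaningful when u is a neighbour of v. *)
Definition next_nbr t v u : vertex N := t.2 (v, u).

Definition nbrs t v : {set vertex N} := [set u | adj t v u].

Definition is_leaf v : bool := if v is inl _ then true else false.

(* One step of the walk that follows the contour of the tree, keeping the tree
   on its left: arriving at v from u, leave along the next edge
   counterclockwise around v. *)
Definition contour t (d : vertex N * vertex N) : vertex N * vertex N :=
  (d.2, next_nbr t d.2 d.1).

Record planar_cubic t : Prop := PlanarCubic {
  pc_sym : symmetric (adj t);
  pc_irrefl : irreflexive (adj t);
  pc_connected : forall u v, connect (adj t) u v;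
  pc_acyclic : forall c, ucycle (adj t) c -> (size c <= 2)%N;
  pc_leaf_degree : forall i, #|nbrs t (inl i)| = 1%N;
  pc_interior_degree : forall i, #|nbrs t (inr i)| = 3%N;
  (* [next_nbr t v] is a cyclic permutation of the neighbours of v *)
  pc_rot_nbrs : forall u v, u \in nbrs t v -> next_nbr t v u \in nbrs t v;
  pc_rot_cyclic : forall u w v, u \in nbrs t v -> w \in nbrs t v ->
    fconnect (next_nbr t v) u w;
  (* going around the tree, the leaf that follows leaf i is leaf i + 1 (mod N):
     the leaves lie on the boundary circle in counterclockwise order *)
  pc_boundary : forall i u, adj t (inl i) u ->
    exists k, (iter k (contour t) (inl i, u)).2 = inl (ordS i) /\
      forall l, (l < k)%N -> ~~ is_leaf (iter l (contour t) (inl i, u)).2 }.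

Definition relabel (f : {perm 'I_N.-2}) v : vertex N :=
  match v with inl i => inl i | inr j => inr (f j) end.

Definition isotopic : rel (ptree N) := fun t t' =>
  [exists f : {perm 'I_N.-2}, forall u, forall v,
    (adj t' (relabel f u) (relabel f v) == adj t u v) &&
    (adj t u v ==>
      (next_nbr t' (relabel f u) (relabel f v) == relabel f (next_nbr t u v)))].

Definition PC : {set {set ptree N}} :=
  equivalence_partition isotopic [set t | `[< planar_cubic t >]]%SET.

Definition interior_edges t : {set {set vertex N}} :=
  [set e | [exists i : 'I_N.-2, exists j : 'I_N.-2,
              adj t (inr i) (inr j) && (e == [set inr i; inr j]%SET)]]%SET.

(* The leaves of the connected component of r in t \ e. *)
Definition edge_side t e (r : vertex N) : {set 'I_N} :=
  [set i | connect (fun u v => adj t u v && ([set u; v]%SET != e))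
                   r (inl i)]%SET.

End Trees.

Section Amplitude.
Context {R : realType} {N : nat}.
Implicit Types (s : 'M[R]_N) (t : ptree N).

Definition mandelstam s :=
  [/\ forall i, s i i = 0, forall i j, s i j = s j i
    & forall i, \sum_j s i j = 0].

(* The component of t \ e is that of an unspecified endpoint of e; the value is
   the same for both components. *)
Definition X_edge s t (e : {set vertex N}) : R :=
  if [pick r in e] is Some r then
    \sum_(i in edge_side t e r) \sum_(j in edge_side t e r | (i < j)%N) s i j
  else 0.

Definition tree_term s t : R := \prod_(e in interior_edges t) (X_edge s t e)^-1.

(* Each class contributes the term of one of its members, which does not depend
   on the member. *)
Definition amplitude s : R :=
  \sum_(C in @PC N) if [pick t in C] is Some t then tree_term s t else 0.

Definition amplitude_regular s :=
  forall t, planar_cubic t ->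
  forall e, e \in interior_edges t -> X_edge s t e != 0.

End Amplitude.

(* The leaves 1, ..., n + 2 are numbered from 0 to n + 1. *)
Definition subst_x {R : realType} {n : nat} (s : 'M[R]_n.+2)
    (p : index_pair n) : R :=
  s (inord (val p).1) (inord (val p).2.+1).

(* The substitution lands in the hyperplane <x, 1> = 0. *)
Lemma sum_subst_x {R : realType} {n : nat} (s : 'M[R]_n.+2) :
  mandelstam s -> \sum_p @subst_x R n s p = 0.
Proof.
move=> [s0 sC s1].
pose S := \sum_(i < n.+1) \sum_(j < n.+1 | (i < j)%N) s (inord i) (inord j).
have -> : \sum_p @subst_x R n s p = S.
  rewrite /S big_ord_recr /= [X in _ = _ + X]big_pred0 => [|j]; last first.
    by apply/negbTE; rewrite -leqNgt -ltnS.
  rewrite addr0.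
  transitivity (\sum_(i < n) \sum_(j < n | (i <= j)%N)
      s (inord i) (inord j.+1)); last first.
    by apply: eq_bigr => i _; rewrite [RHS]big_mkcond big_ord_recl /= add0r -big_mkcond.
  rewrite pair_big_dep /=.
  rewrite [RHS](reindex_omap (fun p : index_pair n => val p) insub) /=; last first.
    by move=> p hp; rewrite insubT.
  apply: eq_big => [[p hp]|p _] //=.
  by rewrite hp insubT eqxx.
have eS : \sum_(i < n.+1) \sum_(j < n.+1) s (inord i) (inord j) = S + S.
  have -> : S + S = S + \sum_(i < n.+1) \sum_(j < n.+1 | (j < i)%N)
                          s (inord i) (inord j).
    congr (_ + _); rewrite /S (exchange_big_dep predT) //=.
    by apply: eq_bigr => i _; apply: eq_bigr => j _; rewrite sC.
  rewrite -big_split /=; apply: eq_bigr => i _.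
  rewrite (bigID (fun j : 'I_n.+1 => (i < j)%N)) /=; congr (_ + _).
  rewrite (bigD1 i) ?ltnn //= s0 add0r; apply: eq_bigl => j.
  by rewrite -leqNgt ltn_neqAle andbC.
have row (i : 'I_n.+2) : \sum_(j < n.+1) s i (inord j) = - s i ord_max.
  have /eqP := s1 i; rewrite big_ord_recr /= addr_eq0 => /eqP <-.
  apply: eq_bigr => j _; congr (s _ _); apply: val_inj.
  by rewrite /= inordK // ltnS ltnW.
have : S + S = 0.
  rewrite -eS; under eq_bigr do rewrite row sC.
  by rewrite sumrN row s0 oppr0 oppr0.
by move=> /eqP; rewrite -mulr2n mulrn_eq0 /= => /eqP.
Qed.

(* Main.v *)
(* Write g(v) for the sum over all intervals [i,j] of min(v_i, ..., v_j).  The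
   dual cone is {g >= 0} and its boundary {g = 0} is a graph over the quotient
   of R^n by the line R(1, ..., 1).  Additivity of g on a convex piece of
   {g = 0} forces additivity of every summand, so each cell of T lies in the cone
   C_t of vectors that increase away from the root of some binary tree t on
   1, ..., n, where every denominator is linear.  C_t is unimodular, generated
   modulo (1, ..., 1) by the indicators of the proper subtrees, and on the
   indicator of [i,j] the denominator is -X_{[i,j+1]}, since the x_ij sum to 0.

   It remains that |det(v_k)| / prod l(v_k), for a linear form l, is additive
   over a subdivision of C_t.  Partial fractions in a generic direction write
   it as a sum over rays v of the same quantity in the quotient by v; the germs
   at v and at -v of a relation between indicators of cones are again relations,
   and their difference kills all cones containing a line, so induction on the
   dimension applies.

   Planar cubic trees with n + 2 leaves, rooted at the last leaf, correspond up
   to isotopy to the binary trees t; the interior edges are the proper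
   subtrees, and the leaves beyond such an edge form an interval. *)
Require Import Defs.
From HB Require Import structures.
From mathcomp Require Import all_boot all_order all_algebra all_fingroup.
From mathcomp Require Import all_classical all_reals all_analysis.
From mathcomp Require Import zify ring lra.
Set Implicit Arguments.
Unset Strict Implicit.
Unset Printing Implicit Defensive.
Import Order.TTheory GRing.Theory Num.Theory.
Import numFieldNormedType.Exports.
Local Open Scope ring_scope.

(** * Signed decompositions into simplicial cones *)

(** If l is positive on the generators, |det(v_k)| / prod l(v_k) is the integral of exp(-l) over the
    cone, and additivity is immediate. Here l is only known to be nonzero at the generators, so
    additivity is proved as an algebraic identity between values, with relations between indicators
    required only off finitely many hyperplanes. The cells have dimension n - 1 and in general lie
    in no common hyperplane; adding the line R(1, ..., 1) to each gives cones of full dimension that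
    cover R^n. Since cones with a line have weight 0, the wanted identity is not the relation of
    weights in dimension n but its germ at (1, ..., 1), where l vanishes because the x_ij sum to 0.
    The sign is (-1)^(n-1): every term has n - 1 denominators, each of them minus the corresponding
    X. *)

Lemma lagrange_at_0 (F : fieldType) n (x : 'I_n.+1 -> F) :
  injective x -> \sum_k \prod_(j | j != k) (x j / (x j - x k)) = 1.
Proof.
move=> xI; have xB j k : j != k -> x j - x k != 0.
  by rewrite subr_eq0 (inj_eq xI).
pose L k := \prod_(j | j != k) ((x j - x k)^-1 *: ((x j)%:P - 'X)).
pose p := \sum_k L k - 1.
have rp i : root p (x i).
  apply/rootP; rewrite !hornerE horner_sum (bigD1 i) //= big1 ?addr0 => [|k ki].
    rewrite horner_prod big1 ?subrr // => j ji.
    by rewrite !hornerE mulVf // xB.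
  rewrite horner_prod (bigD1 i) 1?eq_sym //= !hornerE /= subrr mulr0.
  by rewrite mul0r.
have sp : (size p <= n.+1)%N.
  rewrite (leq_trans (size_polyD _ _)) // geq_max size_polyN size_poly1 andbT.
  rewrite (leq_trans (size_sum _ _ _)) //; apply/bigmax_leqP => k _.
  rewrite (leq_trans (size_prod_leq _ _)) //= cardC1 card_ord.
  rewrite leq_subLR (leq_trans (n := (n * 2).+1)) //.
    rewrite ltnS -[X in (X * 2)%N](_ : #|[pred j | j != k]| = n); last first.
      by rewrite cardC1 card_ord.
    rewrite -sum_nat_const; apply: leq_sum => j _.
    rewrite (leq_trans (size_scale_leq _ _)) // -opprB size_polyN.
    by rewrite size_XsubC.
  by rewrite muln2 -addnn addnS.
have p0 : p = 0.
  apply/eqP; apply: contraT => pn0.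
  have rx : all (root p) (codom x) by apply/allP => _ /codomP[i ->].
  have ux : uniq (codom x) by rewrite map_inj_uniq ?enum_uniq.
  by have := max_poly_roots pn0 rx ux; rewrite size_codom card_ord ltnNge sp.
have : p.[0] = 0 by rewrite p0 horner0.
rewrite !hornerE horner_sum => /eqP; rewrite subr_eq0 => /eqP L1.
rewrite -[RHS]L1; apply: eq_bigr => k _; rewrite horner_prod; apply: eq_bigr => j _.
by rewrite !hornerE subr0 mulrC.
Qed.

(** This is the partial fraction expansion of t |-> 1 / prod_k (l_k - t m_k) at its poles l_k / m_k,
    taken at t = 0. The hypothesis on pairs makes the poles distinct. *)
Lemma prodV_partial_fractions (F : fieldType) n (l m : 'I_n.+1 -> F) :
    (forall k, l k != 0) -> (forall k, m k != 0) ->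
    (forall j k, j != k -> l j * m k != l k * m j) ->
  (\prod_k l k)^-1 =
    \sum_k (l k * \prod_(j | j != k) (l j - l k / m k * m j))^-1.
Proof.
move=> l0 m0 lm.
have mK k : l k / m k * m k = l k by rewrite divfK.
have xI : injective (fun k => l k / m k).
  move=> j k e; apply/eqP; apply: contraT => /lm/eqP[].
  by rewrite -[l j]mK e -[l k in RHS]mK mulrAC.
rewrite -[LHS]mulr1 -[X in _ * X = _](lagrange_at_0 xI) mulr_sumr; apply: eq_bigr => k _.
rewrite (bigD1 k) //= !invfM -mulrA; congr (_ * _).
rewrite -prodfV -[X in _ = X]prodfV -big_split /=; apply: eq_bigr => j jk.
have d0 : l j * m k - l k * m j != 0 by rewrite subr_eq0 lm.
have -> : l j / m j - l k / m k = (l j * m k - l k * m j) / (m j * m k).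
  by field; rewrite !m0.
have -> : l j - l k / m k * m j = (l j * m k - l k * m j) / m k by field; rewrite m0.
by field; rewrite d0 !m0 l0.
Qed.

(** A point (1, t, ..., t^(n-1)) of the moment curve works: each [h] becomes a nonzero polynomial in
    t, and in characteristic 0 some integer avoids the finitely many roots. *)
Lemma avoid_hyperplanes (F : numFieldType) n (H : seq 'rV[F]_n) :
  0 \notin H -> exists m : 'cV[F]_n, forall h, h \in H -> (h *m m) 0 0 != 0.
Proof.
move=> H0; pose P := \prod_(h <- H) rVpoly h.
have P0 : P != 0.
  rewrite prodf_seq_neq0; apply/allP => h hH /=; apply: contraNneq H0 => h0.
  by have <- : h = 0 by rewrite -[h]rVpolyK h0 linear0.
have [t Pt] : exists t, ~~ root P t.
  pose s := [seq i%:R : F | i <- iota 0 (size P)].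
  have [rs | /allPn[t _ ?]] := boolP (all (root P) s); last by exists t.
  have us : uniq s.
    by rewrite map_inj_uniq ?iota_uniq //; exact: mulrIn (oner_neq0 F).
  by have := max_poly_roots P0 rs us; rewrite size_map size_iota ltnn.
exists (\col_i t ^+ i) => h hH.
apply: contraNneq Pt => ht; rewrite /root horner_prod prodf_seq_eq0.
apply/hasP; exists h => //=.
rewrite horner_poly -[X in _ == X]ht mxE; apply/eqP; apply: eq_bigr => i _.
by rewrite valK mxE.
Qed.

(** With such an [e], the number a + e b has the sign of a for every pair with a nonzero, so a small
    step preserves all strict inequalities at the starting point. *)
Lemma small_perturbation (F : realFieldType) (s : seq (F * F)) :
  exists2 e, 0 < e & forall a b, (a, b) \in s -> a != 0 -> e * `|b| < `|a|.
Proof.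
elim: s => [|[a b] s [e e0 he]]; first by exists 1.
have [->|a0] := eqVneq a 0.
  exists e => // a' b'; rewrite inE => /orP[/eqP[-> _]|/he//].
  by rewrite eqxx.
have b1 : 0 < `|b| + 1 by rewrite ltr_wpDl.
pose e' := `|a| / (`|b| + 1).
have e'0 : 0 < e' by rewrite divr_gt0 ?normr_gt0.
exists (Num.min e e') => [|a' b']; first by rewrite lt_min e0.
rewrite inE => /orP[/eqP[-> ->] _|/he h /h]; last first.
  by apply: le_lt_trans; rewrite ler_wpM2r // ge_min lexx.
apply: (@le_lt_trans _ _ (e' * `|b|)).
  by rewrite ler_wpM2r // ge_min lexx orbT.
by rewrite /e' mulrAC ltr_pdivrMr // ltr_pM2l ?normr_gt0 // ltrDl.
Qed.

(** * Relations between indicators of cones, and their germs *)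

Section Germs.
Variable F : realFieldType.

(* A simplicial cone with the generators in [L] allowed both signs. *)
Definition in_gcone d (B : 'M[F]_d) (L : {set 'I_d}) (p : 'rV[F]_d) : bool :=
  [forall j, (j \notin L) ==> (0 <= (p *m invmx B) 0 j)].

(** Points on finitely many hyperplanes are ignored because the pieces of a subdivision overlap
    along their faces. A zero column in [H] would leave no point to test. *)
Definition generically_zero d (I : finType) (a : I -> F) (B : I -> 'M[F]_d)
    (L : I -> {set 'I_d}) :=
  exists2 H : seq 'cV[F]_d, 0 \notin H &
    forall p : 'rV[F]_d, (forall h, h \in H -> (p *m h) 0 0 != 0) ->
    \sum_i a i *+ in_gcone (B i) (L i) p = 0.

(** For [l] positive on the rows of [B] and [L] empty, this is the integral of exp(-l) over the
    cone. Cones containing a line get 0, as under the Khovanskii-Pukhlikov-Lawrence valuation. *)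
Definition cone_weight d (B : 'M[F]_d) (L : {set 'I_d}) (l : 'cV[F]_d) : F :=
  if L == finset.set0 then `|\det B| / \prod_j (B *m l) j 0 else 0.

Definition weights_cancel d := forall (I : finType) (a : I -> F)
    (B : I -> 'M[F]_d) (L : I -> {set 'I_d}) (l : 'cV[F]_d),
  (forall i, B i \in unitmx) -> generically_zero a B L ->
  (forall i j, (B i *m l) j 0 != 0) ->
  \sum_i a i * cone_weight (B i) (L i) l = 0.

(** Cramer's rule for the coordinates of [v] in the rows of [B]. *)
Lemma det_replace_row d (B : 'M[F]_d) (v : 'rV[F]_d) k : B \in unitmx ->
  \det (\matrix_(i, j) if i == k then v 0 j else B i j) =
  (v *m invmx B) 0 k * \det B.
Proof.
move=> uB; have dB : \det B != 0 by rewrite -unitfE -unitmxE.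
rewrite (expand_det_row _ k) mxE mulr_suml; apply: eq_bigr => j _.
rewrite /invmx uB !mxE eqxx -mulrA [_ * \det B]mulrC mulVKf //; congr (_ * _).
rewrite /cofactor; congr (_ * \det _).
by apply/matrixP => i i'; rewrite !mxE [_ == k]eq_sym (negPf (neq_lift _ _)).
Qed.

(** [Q] is the projection along the line of [v] and [S] a section of it; a form that kills [v]
    factors through [Q]. The constant [k0] compares volumes before and after projection, and depends
    neither on the basis nor on the deleted row. *)
Lemma line_quotient d (v : 'rV[F]_d.+1) : v != 0 ->
  exists (Q : 'M[F]_(d.+1, d)) (S : 'M[F]_(d, d.+1)) (k0 : F),
  [/\ 0 < k0, v *m Q = 0, S *m Q = 1%:M,
      forall h : 'cV[F]_d.+1, (v *m h) 0 0 = 0 -> h = Q *m (S *m h)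
    & forall B k, B \in unitmx ->
        `|\det B| * `|(v *m invmx B) 0 k| = k0 * `|\det (row' k B *m Q)|].
Proof.
(* After multiplication by [E], only the first coordinate of [v] is nonzero, and it equals [c]. *)
move=> v0; pose E := invmx (row_ebase v).
have uE : E \in unitmx by rewrite unitmx_inv row_ebase_unit.
pose c := col_ebase v 0 0.
have vE j : (v *m E) 0 j = if j == 0 then c else 0.
  rewrite -{1}[v]mulmx_ebase mulmxK ?row_ebase_unit // mxE big_ord1 mxE /=.
  by rewrite rank_rV v0 andbT eq_sym -val_eqE /=; case: eqP; rewrite ?mulr1 ?mulr0.
have c0 : c != 0.
  apply: contraNneq v0 => c0; rewrite -[v](mulmxK uE); apply/eqP.
  rewrite [v *m E](_ : _ = 0) ?mul0mx //; apply/rowP => j.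
  by rewrite vE c0 if_same mxE.
have dE : \det E != 0 by rewrite -unitfE -unitmxE.
exists (col' 0 E), (row' 0 (invmx E)), (`|c| / `|\det E|); split.
- by rewrite divr_gt0 ?normr_gt0.
- apply/rowP => j; have := vE (lift 0 j); rewrite /= => vEj.
  rewrite [RHS]mxE -[RHS]vEj !mxE; apply: eq_bigr => i _.
  by rewrite mxE.
- apply/matrixP => i j; have /matrixP/(_ (lift 0 i) (lift 0 j)) := mulVmx uE.
  rewrite !mxE (inj_eq lift_inj) => <-.
  by apply: eq_bigr => k _; rewrite !mxE.
- move=> h vh; rewrite -{1}[h](mulKVmx uE); apply/matrixP => i j.
  rewrite (ord1 j) mxE big_ord_recl.
  have -> : (invmx E *m h) 0 0 = 0.
    apply: (mulfI c0); rewrite mulr0 -[RHS]vh.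
    have -> : v *m h = v *m E *m (invmx E *m h) by rewrite mulmxA mulmxK.
    rewrite [RHS]mxE (bigD1 0) //= big1 ?addr0 ?vE ?eqxx // => k k0.
    by rewrite vE (negPf k0) mul0r.
  rewrite mulr0 add0r [RHS]mxE; apply: eq_bigr => k _.
  by rewrite !mxE; congr (_ * _); apply: eq_bigr => k' _; rewrite mxE.
move=> B k uB; rewrite mulrC -normrM -(det_replace_row _ _ uB).
set B' := (X in \det X).
have <- : row' k (col' 0 (B' *m E)) = row' k B *m col' 0 E.
  apply/matrixP => i j; rewrite !mxE; apply: eq_bigr => k' _.
  by rewrite !mxE [_ == k]eq_sym (negPf (neq_lift _ _)).
have rowk j : (B' *m E) k j = (v *m E) 0 j.
  by rewrite !mxE; apply: eq_bigr => i _; rewrite !mxE eqxx.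
apply: (mulIf (x := `|\det E|)); rewrite ?normr_eq0 // -normrM -det_mulmx.
rewrite (expand_det_row _ k) (bigD1 0) //= big1 ?addr0 => [|j j0].
  rewrite rowk vE eqxx /cofactor !normrM normrX normrN1 expr1n mul1r.
  by rewrite mulrAC divfK ?normr_eq0.
by rewrite rowk vE (negPf j0) mul0r.
Qed.

(** For a form [l] that kills [v], this is, up to the constant of [line_quotient], the weight of the
    germ at [v] in the quotient by [v]. It is nonzero only if the germ contains no line besides that
    of [v], so that [v] lies on the k-th ray, or on the k-th line when [L] is {k}. *)
Definition germ_weight d (v : 'rV[F]_d) (B : 'M[F]_d) (L : {set 'I_d})
    (l : 'cV[F]_d) : F :=
  let y := v *m invmx B in
  \sum_k (if [&& L \subset [set k], [forall j, (j != k) ==> (y 0 j == 0)]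
               & (0 < y 0 k) || (k \in L)]
          then `|\det B| * `|y 0 k| / \prod_(j | j != k) (B *m l) j 0 else 0).

(* The germ at v of a generalised cone is invariant under translation along v;
   dividing by v turns the germs into cones of one dimension less. *)
Lemma germ_weights_cancel d (I : finType) (a : I -> F) (B : I -> 'M[F]_d.+1)
    (L : I -> {set 'I_d.+1}) (v : 'rV[F]_d.+1) (l : 'cV[F]_d.+1) :
  weights_cancel d -> (forall i, B i \in unitmx) -> generically_zero a B L ->
  v != 0 -> (v *m l) 0 0 = 0 ->
  (forall i j k, j != k -> (v *m invmx (B i)) 0 k != 0 -> (B i *m l) j 0 != 0) ->
  \sum_i a i * germ_weight v (B i) (L i) l = 0.
Proof.
move=> IH uB [H H0 gz] v0 vl l0.
pose y i := v *m invmx (B i).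
have yE i : \sum_j y i 0 j *: row j (B i) = v.
  by rewrite -mulmx_sum_row mulmxKV.
have /fin_all_exists[k yk] i : exists k, y i 0 k != 0.
  apply/existsP; apply: contraNT v0 => /existsPn y0.
  by rewrite -(yE i) big1 // => j _; have /negPn/eqP-> := y0 j; rewrite scale0r.
have [Q [S [c [c0 vQ SQ QS detQ]]]] := line_quotient v0.
pose C i := row' (k i) (B i) *m Q.
(* Near [v], a constraint that is slack at [v] is void, so its generator joins [L']; a constraint
   that fails at [v] empties the germ, so the coefficient becomes 0. *)
pose L' i := [set j | (lift (k i) j \in L i) || (y i 0 (lift (k i) j) != 0)].
pose a' i := if [exists j, (j \notin L i) && (y i 0 j < 0)] then 0 else a i.
have uC i : C i \in unitmx.
  rewrite unitmxE unitfE -normr_eq0.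
  have : c * `|\det (C i)| != 0; last by rewrite mulf_eq0 => /norP[].
  rewrite -detQ // mulf_eq0 !normr_eq0 (negPf (yk i)) orbF.
  by rewrite -unitfE -unitmxE.
have CQ i j : (C i *m (S *m l)) j 0 = (B i *m l) (lift (k i) j) 0.
  rewrite /C -mulmxA -QS // !mxE; apply: eq_bigr => j' _.
  by rewrite mxE.
have gz' : generically_zero a' C L'.
  (* Only the hyperplanes through [v] matter; the others are avoided by every small perturbation of
     [v]. *)
  exists [seq S *m h | h <- H & (v *m h) 0 0 == 0].
    apply/mapP => -[h]; rewrite mem_filter => /andP[/eqP vh hH] Sh.
    by case/negP: H0; rewrite (_ : 0 = h) // [RHS]QS // -Sh mulmx0.
  (* The relation is evaluated at [v + e *: p0], with [e] so small that every nonzero value at [v]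
     keeps its sign. *)
  move=> q hq; pose p0 := q *m S.
  pose s := [seq ((v *m h) 0 0, (p0 *m h) 0 0) | h <- H] ++
    [seq (y ij.1 0 ij.2, (p0 *m invmx (B ij.1)) 0 ij.2) | ij : I * 'I_d.+1].
  have [e e0 he] := small_perturbation s.
  have sgn_add x z : (x, z) \in s -> x != 0 -> (x + e * z != 0) /\
      ((0 <= x + e * z) = (0 <= x)).
    move=> /he h /h {}h.
    have : `|e * z| < `|x| by rewrite normrM (gtr0_norm e0).
    have := ler_norm (e * z); have := ler_norm (- (e * z)); rewrite normrN.
    case: (ltgtP x 0) => [x0|x0|->] h1 h2; last by rewrite normr0 ltNge normr_ge0.
      rewrite (ltr0_norm x0) => h3; have n0 : x + e * z < 0 by lra.
      by split; [rewrite lt_eqF | rewrite leNgt n0].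
    rewrite (gtr0_norm x0) => h3; have n0 : 0 < x + e * z by lra.
    by split; [rewrite gt_eqF | rewrite ltW].
  have addE x (h : 'M[F]_(d.+1, x)) i j :
      ((v + e *: p0) *m h) i j = (v *m h) i j + e * (p0 *m h) i j.
    by rewrite mulmxDl -scalemxAl !mxE.
  rewrite -[RHS](gz (v + e *: p0)) => [|h hH]; last first.
    rewrite addE; have [vh|vh] := eqVneq ((v *m h) 0 0) 0.
      rewrite vh add0r mulf_eq0 gt_eqF //= -mulmxA; apply: hq.
      by apply: map_f; rewrite mem_filter vh eqxx.
    by apply: (sgn_add _ _ _ vh).1; rewrite mem_cat map_f.
  apply: eq_bigr => i _.
  pose x := p0 *m invmx (B i).
  have memx j : (y i 0 j, x 0 j) \in s.
    by rewrite mem_cat; apply/orP; right; apply/fintype.imageP; exists (i, j).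
  have qC : q *m invmx (C i) =
      \row_j (x 0 (lift (k i) j) - x 0 (k i) / y i 0 (k i) * y i 0 (lift (k i) j)).
    apply: (canLR (mulmxK (uC i))); rewrite -[LHS](mulmx1) -SQ mulmxA -/p0.
    rewrite /C mulmxA; apply/eqP; rewrite -subr_eq0 -mulmxBl; apply/eqP.
    set r := _ - _; suff -> : r = (x 0 (k i) / y i 0 (k i)) *: v.
      by rewrite -scalemxAl vQ scaler0.
    rewrite /r -[p0 in LHS](mulmxKV (uB i)) -/x -(yE i).
    rewrite !mulmx_sum_row scaler_sumr (bigD1_ord (k i)) //= [RHS](bigD1_ord (k i)) //=.
    rewrite scalerA divfK // -addrA; congr (_ + _); rewrite -sumrB.
    apply: eq_bigr => j _; rewrite mxE scalerA.
    have -> : row j (row' (k i) (B i)) = row (lift (k i) j) (B i).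
      by apply/rowP => ?; rewrite !mxE.
    by rewrite -scalerBl opprB addrC subrK.
  rewrite /a'; case: ifPn => [/existsP[j /andP[jL yj]]|/existsPn yL].
    rewrite mul0rn; have := sgn_add _ _ (memx j); rewrite lt_eqF // => /(_ isT)[_ s2].
    have /negPf-> : ~~ in_gcone (B i) (L i) (v + e *: p0); last by rewrite mulr0n.
    apply/forallPn; exists j; rewrite jL /= addE -/x -/(y i) s2.
    by rewrite -ltNge.
  congr (_ *+ nat_of_bool _); apply/forallP/forallP => h j; apply/implyP => jL.
    rewrite addE -/x -/(y i).
    have y0 : 0 <= y i 0 j by have := yL j; rewrite jL /= -leNgt.
    have [yj|yj] := eqVneq (y i 0 j) 0; last by rewrite (sgn_add _ _ _ yj).2.
    rewrite yj add0r pmulr_rge0 //.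
    case: (unliftP (k i) j) yj jL => [j' ->|->] yj jL; last by have := yk i; rewrite yj eqxx.
    have := h j'; rewrite inE (negPf jL) yj eqxx qC mxE yj mulr0 subr0.
    exact.
  move: jL; rewrite inE negb_or negbK => /andP[jL /eqP yj].
  have := h (lift (k i) j); rewrite jL addE -/x -/(y i) yj add0r pmulr_rge0 //.
  by rewrite qC [X in _ -> 0 <= X]mxE yj mulr0 subr0.
have lC i j : (C i *m (S *m l)) j 0 != 0.
  by rewrite CQ; apply: (l0 i _ (k i)) (yk i); rewrite eq_sym neq_lift.
rewrite -[RHS](mulr0 c) -[X in _ = c * X](IH I a' C L' (S *m l) uC gz' lC).
rewrite mulr_sumr; apply: eq_bigr => i _.
rewrite /germ_weight -/(y i) (bigD1 (k i)) //= [X in _ + X]big1 ?addr0 => [|j jk]; last first.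
  case: ifP => // /and3P[_ /forallP/(_ (k i))]; rewrite eq_sym jk /= => yki _.
  by rewrite (negPf (yk i)) in yki.
rewrite /cone_weight /a'.
have prodE : \prod_(j | j != k i) (B i *m l) j 0 = \prod_j (C i *m (S *m l)) j 0.
  rewrite (eq_bigr _ (fun j _ => CQ i j)).
  rewrite (reindex_omap (lift (k i)) (unlift (k i))) /=; last first.
    by move=> j; case: unliftP => [j' ->|->] //; rewrite eqxx.
  by apply: eq_bigl => j; rewrite liftK eqxx eq_sym neq_lift.
(* [L' i] is empty exactly when [v] is proportional to row [k i] and no other row spans a line. The
   sign condition of the germ weight is carried by [a']. *)
have [L0|L0] := eqVneq (L' i) finset.set0; last first.
  rewrite !mulr0; case: ifP => [/and3P[Lk /forallP yj _]|]; last by rewrite mulr0.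
  have [j] := finset.set0Pn _ L0; rewrite inE => /orP[jL|].
    by have := fintype.subsetP Lk _ jL; rewrite inE eq_sym (negPf (neq_lift _ _)).
  by have := yj (lift (k i) j); rewrite eq_sym neq_lift /= => /eqP->; rewrite eqxx.
have Lk : L i \subset [set k i].
  apply/fintype.subsetP => j jL; rewrite inE; case: (unliftP (k i) j) jL => [j' ->|->] //.
  by move=> jL; have := finset.in_set0 j'; rewrite -L0 inE jL.
have yj : [forall j, (j != k i) ==> (y i 0 j == 0)].
  apply/forallP => j; case: (unliftP (k i) j) => [j' ->|->]; last by rewrite eqxx.
  by apply/implyP => _; have := finset.in_set0 j'; rewrite -L0 inE => /norP[_]/negPn.
rewrite Lk yj /= detQ // prodE.
have [pos|] := boolP (_ || _).
  have /negPf-> : ~~ [exists j, (j \notin L i) && (y i 0 j < 0)].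
    apply/existsPn => j; rewrite negb_and negbK -leNgt.
    have [->|jk] := eqVneq j (k i).
      by case/orP: pos => [/ltW->|->]; rewrite ?orbT.
    by have := forallP yj j; rewrite jk => /eqP->; rewrite lexx orbT.
  by rewrite mulrCA !mulrA -/(C i) [c * _ * a i]mulrAC.
rewrite negb_or -leNgt => /andP[yk0 kL]; rewrite ifT ?mulr0 ?mul0r ?mulr0 //.
by apply/existsP; exists (k i); rewrite kL lt_neqAle yk yk0.
Qed.

(** If [L] is {k}, the germs at [v] and [- v] have the same weight and cancel; for larger [L] both
    weights vanish. For [L] empty, the two signs of the coordinate combine to remove its absolute
    value. *)
Lemma germ_weight_diff d (v : 'rV[F]_d) (B : 'M[F]_d) (L : {set 'I_d}) l :
  germ_weight v B L l - germ_weight (- v) B L l =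
  if L == finset.set0 then
    \sum_(k | [forall j, (j != k) ==> ((v *m invmx B) 0 j == 0)])
       `|\det B| * (v *m invmx B) 0 k / \prod_(j | j != k) (B *m l) j 0
  else 0.
Proof.
rewrite /germ_weight -sumrB mulNmx; set y := v *m invmx B.
have yN j : (- y) 0 j = - y 0 j by rewrite [LHS]mxE.
have NyE k : [forall j, (j != k) ==> ((- y) 0 j == 0)] =
             [forall j, (j != k) ==> (y 0 j == 0)].
  by apply: eq_forallb => j; rewrite yN oppr_eq0.
have [->|/finset.set0Pn[k0 k0L]] := eqVneq L finset.set0; last first.
  rewrite big1 // => k _; rewrite NyE yN normrN.
  have [Lk|] := boolP (L \subset [set k]); last by rewrite subrr.
  have <- : k0 = k by apply/eqP; have := fintype.subsetP Lk _ k0L; rewrite inE.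
  by rewrite k0L !orbT subrr.
rewrite /= [RHS]big_mkcond /=; apply: eq_bigr => k _.
rewrite NyE yN normrN finset.sub0set inE !orbF oppr_gt0.
case: [forall j, (j != k) ==> (y 0 j == 0)] => /=; last by rewrite subrr.
case: (ltgtP (y 0 k) 0) => [yk0|yk0|->].
- by rewrite sub0r (ltr0_norm yk0) mulrN mulNr opprK.
- by rewrite subr0 (gtr0_norm yk0).
by rewrite mulr0 mul0r subrr.
Qed.

(* A ray is represented by its generator u with m(u) = 1; the terms at u are
   germ weights for the form l - l(u) m, which vanishes at u. *)
Lemma cone_weights_cancel d : weights_cancel d.
Proof.
elim: d => [|d IH] I a B L l uB gz l0.
  have [H H0 gz0] := gz; rewrite -[RHS](gz0 0) => [|h hH]; last first.
    by case/negP: H0; rewrite (_ : 0 = h) //; apply/matrixP => -[].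
  apply: eq_bigr => i _; rewrite /cone_weight det_mx00 normr1 big_ord0 divr1.
  rewrite ifT ?mulr1; last by apply/eqP/finset.setP => -[].
  by rewrite (_ : in_gcone _ _ _) //; apply/forallP => -[].
(* [nonpar] is a combination of two rows that [l] kills, and it is zero only for parallel rows. A
   generic [m] is nonzero on all the others, so l / m takes different values at rows that are not
   parallel. *)
pose nonpar (ij i'k : I * 'I_d.+1) :=
  (B ij.1 *m l) ij.2 0 *: row i'k.2 (B i'k.1) - (B i'k.1 *m l) i'k.2 0 *: row ij.2 (B ij.1).
have [m mP] : exists m : 'cV[F]_d.+1, forall h, h \in
    [seq h <- [seq row ij.2 (B ij.1) | ij : I * 'I_d.+1] ++
      [seq nonpar p.1 p.2 | p : (I * 'I_d.+1) * (I * 'I_d.+1)] | h != 0] ->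
    (h *m m) 0 0 != 0.
  by apply: avoid_hyperplanes; rewrite mem_filter eqxx.
have rowm i j (h : 'cV[F]_d.+1) : (row j (B i) *m h) 0 0 = (B i *m h) j 0.
  by rewrite -row_mul mxE.
have row0 i j : row j (B i) != 0.
  by apply: contraNneq (l0 i j) => r0; rewrite -rowm r0 mul0mx mxE.
have m0 i j : (B i *m m) j 0 != 0.
  rewrite -rowm mP // mem_filter row0 mem_cat; apply/orP; left.
  by apply/fintype.imageP; exists (i, j).
have subE p q (x y : 'M[F]_(p, q)) (c c' : F) i j :
    (c *: x - c' *: y) i j = c * x i j - c' * y i j by rewrite !mxE.
have npar i j i' k : nonpar (i, j) (i', k) != 0 ->
    (B i *m l) j 0 * (B i' *m m) k 0 != (B i' *m l) k 0 * (B i *m m) j 0.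
  move=> n0; rewrite -subr_eq0.
  have := mP (nonpar (i, j) (i', k)); rewrite mem_filter n0 mem_cat /=.
  rewrite mulmxBl -!scalemxAl subE !rowm; apply.
  by apply/orP; right; apply/fintype.imageP; exists ((i, j), (i', k)).
have rowI i j k (c c' : F) : j != k -> c != 0 ->
    c *: row k (B i) - c' *: row j (B i) != 0.
  move=> jk; apply: contraNneq => /(congr1 (mulmx^~ (invmx (B i)))) /eqP.
  rewrite mulmxBl -!scalemxAl -!row_mul mulmxV // mul0mx => /eqP/rowP/(_ k).
  by rewrite !mxE eqxx (negPf jk) mulr0 subr0 mulr1 => ->.
pose u (ik : I * 'I_d.+1) := ((B ik.1 *m m) ik.2 0)^-1 *: row ik.2 (B ik.1).
pose U := undup [seq u ik | ik : I * 'I_d.+1].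
pose lam (w : 'rV[F]_d.+1) := (w *m l) 0 0.
pose lu w := l - lam w *: m.
pose t i k := `|\det (B i)| /
  ((B i *m l) k 0 * \prod_(j | j != k) (B i *m lu (u (i, k))) j 0).
have luE w i j : (B i *m lu w) j 0 = (B i *m l) j 0 - lam w * (B i *m m) j 0.
  by rewrite mulmxBr -scalemxAr -[in LHS](scale1r (B i *m l)) subE mul1r.
have lamu i k : lam (u (i, k)) = (B i *m l) k 0 / (B i *m m) k 0.
  by rewrite /lam /u -scalemxAl mxE rowm mulrC.
have wE i : L i = finset.set0 -> cone_weight (B i) (L i) l = \sum_k t i k.
  move=> Li; rewrite /cone_weight Li eqxx.
  rewrite (prodV_partial_fractions (l0 i) (m0 i)) => [|j k jk]; last first.
    by apply: npar; apply: rowI.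
  rewrite mulr_sumr; apply: eq_bigr => k _; congr (_ / (_ * _)).
  by apply: eq_bigr => j _; rewrite luE lamu.
have um i k : (u (i, k) *m m) 0 0 = 1.
  by rewrite /u -scalemxAl mxE rowm mulVf.
(* The partial fraction terms of all cones are regrouped by their normalised rays; cones with a line
   contribute nothing. *)
rewrite (eq_bigr (fun i => \sum_(w <- U) if L i == finset.set0 then
   a i * \sum_(k | u (i, k) == w) t i k else 0)) => [|i _]; last first.
  case: eqP => [Li|/eqP Li]; last by rewrite /cone_weight (negPf Li) mulr0 big1_eq.
  rewrite wE // -mulr_sumr; congr (_ * _).
  rewrite (exchange_big_dep predT) //=; apply: eq_bigr => k _.
  rewrite -big_filter (bigD1_seq (u (i, k))) ?filter_uniq ?undup_uniq //=; last first.
    rewrite mem_filter eqxx mem_undup; apply/fintype.imageP; by exists (i, k).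
  rewrite big_filter_cond big1 ?addr0 // => w /andP[/eqP-> ].
  by rewrite eqxx.
rewrite exchange_big /= big1_seq // => w /andP[_]; rewrite mem_undup.
case/fintype.imageP => -[i0 k0] _ wE0.
have wm : (w *m m) 0 0 = 1 by rewrite wE0 um.
have lw0 : lam w != 0 by rewrite wE0 lamu mulf_neq0 ?invr_eq0.
have w0 : w != 0 by apply: contraNneq lw0 => ->; rewrite /lam mul0mx mxE.
have wlu : (w *m lu w) 0 0 = 0.
  by rewrite mulmxBr -scalemxAr -(scale1r (w *m l)) subE mul1r wm mulr1 subrr.
have coordne i j k : j != k -> (w *m invmx (B i)) 0 k != 0 -> (B i *m lu w) j 0 != 0.
  move=> jk wk; rewrite luE wE0 lamu -(inj_eq (mulIf (m0 i0 k0))) mul0r mulrBl.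
  rewrite mulrAC divfK // subr_eq0; apply: npar; rewrite /nonpar /=.
  apply: contraNneq wk => /(congr1 (mulmx^~ (invmx (B i)))) /eqP.
  rewrite mulmxBl -!scalemxAl -(row_mul j) mulmxV // mul0mx => /eqP/rowP/(_ k).
  have r1 : (row j (1%:M : 'M[F]_d.+1)) 0 k = 0 by rewrite !mxE (negPf jk).
  have z0 : (0 : 'rV[F]_d.+1) 0 k = 0 by rewrite mxE.
  rewrite subE r1 z0 mulr0 subr0 => /eqP; rewrite mulf_eq0 (negPf (l0 _ _)) /=.
  by move=> /eqP wk; apply/eqP; rewrite wE0 /u -scalemxAl [LHS]mxE wk mulr0.
have g1 := germ_weights_cancel IH uB gz w0 wlu coordne.
have : \sum_i a i * germ_weight (- w) (B i) (L i) (lu w) = 0.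
  apply: germ_weights_cancel; rewrite ?oppr_eq0 //.
    by rewrite mulNmx mxE wlu oppr0.
  by move=> i j k jk; rewrite mulNmx mxE oppr_eq0; apply: coordne.
(* The terms at [w] add up to 1 / l(w) times the difference of the germ relations at [w] and
   [- w]. *)
move/(congr1 (fun z => (lam w)^-1 * ((\sum_i a i * germ_weight w (B i) (L i) (lu w)) - z))).
rewrite {2}g1 subr0 mulr0 => g2; rewrite -[RHS]g2 -sumrB mulr_sumr.
apply: eq_bigr => i _; rewrite -mulrBr germ_weight_diff.
case: ifP => _; last by rewrite !mulr0.
rewrite mulrCA; congr (_ * _); rewrite mulr_sumr; apply: eq_big => k.
  apply/eqP/forallP => [<- j|wk].
    apply/implyP => jk; rewrite /u -scalemxAl -row_mul mulmxV //.
    by rewrite !mxE (eq_sym k) (negPf jk) mulr0.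
  have wk' : w = (w *m invmx (B i)) 0 k *: row k (B i).
    rewrite -[LHS](mulmxKV (uB i)) mulmx_sum_row (bigD1 k) //= big1 ?addr0 // => j jk.
    by have := wk j; rewrite jk => /eqP->; rewrite scale0r.
  rewrite /u [RHS]wk'; congr (_ *: _).
  by apply: (mulIf (m0 i k)); rewrite mulVf //= -rowm -[LHS]wm {1}wk' -scalemxAl mxE.
(* The coordinate 1 / m(row k) of the normalised ray may be negative, the ray then pointing against
   the row; this is why the signed coordinate is needed. *)
move=> /eqP wk; rewrite /t -wk lamu.
have -> : (u (i, k) *m invmx (B i)) 0 k = ((B i *m m) k 0)^-1.
  by rewrite /u -scalemxAl -row_mul mulmxV // !mxE eqxx mulr1.
rewrite invf_div invfM mulrCA !mulrA; congr (_ / _).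
by field; rewrite l0 m0.
Qed.

End Germs.

(** * Binary trees and their cones *)

Inductive shape := Tip | Bin of shape & shape.

Lemma shape_comparable : comparable shape.
Proof. by move=> x y; rewrite /decidable; decide equality. Qed.

HB.instance Definition _ := hasDecEq.Build shape (compareP shape_comparable).

Fixpoint ssize t := if t is Bin l r then (ssize l + ssize r).+1 else 0%N.

(** The bound is on the height, which is at most the number of nodes. *)
Fixpoint shapes_upto k :=
  if k is k'.+1 then
    Tip :: [seq Bin l r | l <- shapes_upto k', r <- shapes_upto k']
  else [:: Tip].

Definition shapes n := undup [seq t <- shapes_upto n | ssize t == n].

Lemma mem_shapes n t : (t \in shapes n) = (ssize t == n).
Proof.
rewrite mem_undup mem_filter andb_idr // => /eqP <-{n}.
suff {t} H k t : (ssize t <= k)%N -> t \in shapes_upto k by exact: H.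
elim: k t => [|k IH] [|l r]; rewrite /= ?mem_head // => lrk.
rewrite in_cons; apply/orP; right.
apply: allpairs_f; apply: IH; lia.
Qed.

Lemma shapes_uniq n : uniq (shapes n).
Proof. exact: undup_uniq. Qed.

(* The nodes of a shape are numbered in infix order, starting from [o]; the
   nodes below [c] are then consecutive, and [ivl t o c] is the first of them
   together with their number. *)
Fixpoint ivl t o c : nat * nat :=
  if t is Bin l r then
    if (c < o + ssize l)%N then ivl l o c
    else if c == (o + ssize l)%N then (o, ssize t)
    else ivl r (o + ssize l).+1 c
  else (o, 0%N).

Definition below t o c j : bool :=
  ((ivl t o c).1 <= j < (ivl t o c).1 + (ivl t o c).2)%N.

Definition node t o c : bool := (o <= c < o + ssize t)%N.

Definition sroot t o := if t is Bin l _ then (o + ssize l)%N else o.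

Lemma nodeP l r o c : node (Bin l r) o c ->
  [\/ node l o c /\ (c < o + ssize l)%N, c = (o + ssize l)%N
    | node r (o + ssize l).+1 c /\ (o + ssize l < c)%N].
Proof.
rewrite /node /= => h; case: (ltngtP c (o + ssize l)) => h'.
- by apply: Or31; split => //; lia.
- by apply: Or33; split => //; lia.
by apply: Or32.
Qed.

Lemma ivl_l l r o c : (c < o + ssize l)%N -> ivl (Bin l r) o c = ivl l o c.
Proof. by move=> /= ->. Qed.

Lemma ivl_r l r o c : (o + ssize l < c)%N ->
  ivl (Bin l r) o c = ivl r (o + ssize l).+1 c.
Proof. by move=> /=; case: ltngtP. Qed.

Lemma ivl_root l r o : ivl (Bin l r) o (o + ssize l) = (o, ssize (Bin l r)).
Proof. by rewrite /= ltnn eqxx. Qed.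

Lemma below_l l r o c j : (c < o + ssize l)%N ->
  below (Bin l r) o c j = below l o c j.
Proof. by move=> h; rewrite /below ivl_l. Qed.

Lemma below_r l r o c j : (o + ssize l < c)%N ->
  below (Bin l r) o c j = below r (o + ssize l).+1 c j.
Proof. by move=> h; rewrite /below ivl_r. Qed.

Lemma below_root l r o j :
  below (Bin l r) o (o + ssize l) j = node (Bin l r) o j.
Proof. by rewrite /below ivl_root. Qed.

Lemma ivl_range t o c : node t o c ->
  (o <= (ivl t o c).1)%N /\ ((ivl t o c).1 + (ivl t o c).2 <= o + ssize t)%N.
Proof.
elim: t o => [|l IHl r IHr] o; first by rewrite /node /=; lia.
case/nodeP => [[h lt]|->|[h gt]].
- by rewrite ivl_l //=; have := IHl _ h; lia.
- by rewrite ivl_root /=; lia.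
by rewrite ivl_r //=; have := IHr _ h; lia.
Qed.

Lemma below_node t o c j : node t o c -> below t o c j -> node t o j.
Proof. by move=> /ivl_range; rewrite /below /node; lia. Qed.

Lemma below_refl t o c : node t o c -> below t o c c.
Proof.
elim: t o => [|l IHl r IHr] o; first by rewrite /node /=; lia.
move=> h; move: (h); case/nodeP => [[h' lt]|e|[h' gt]].
- by rewrite below_l // IHl.
- by rewrite e below_root -e.
by rewrite below_r // IHr.
Qed.

Lemma below_sroot t o j : node t o j -> below t o (sroot t o) j.
Proof. by case: t => [|l r] h; rewrite ?below_root //; move: h; rewrite /node /=; lia. Qed.

Lemma node_sroot t o j : node t o j -> node t o (sroot t o).
Proof. by rewrite /node; case: t => [|l r] /=; lia. Qed.

(** Subtree size as a strictly monotone measure: it makes [below] antisymmetric and [node_mx]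
    triangular in a suitable order. *)
Lemma below_size t o c j : node t o c -> below t o c j ->
  ((ivl t o j).2 <= (ivl t o c).2)%N /\
  ((ivl t o j).2 = (ivl t o c).2 -> j = c).
Proof.
elim: t o => [|l IHl r IHr] o; first by rewrite /node /=; lia.
case/nodeP => [[h lt]|->|[h gt]].
- rewrite below_l // => b; have lt' := below_node h b.
  rewrite !ivl_l //; first exact: IHl.
  by move: lt'; rewrite /node; lia.
- rewrite below_root => hj; rewrite ivl_root.
  move: hj => /nodeP[[h' lt']|->|[h' gt']].
  + by rewrite ivl_l //=; have [] := ivl_range h'; lia.
  + by rewrite ivl_root.
  by rewrite ivl_r //=; have [] := ivl_range h'; lia.
rewrite below_r // => b; have gt' := below_node h b.
rewrite !ivl_r //; first exact: IHr.
by move: gt'; rewrite /node; lia.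
Qed.

(** [p] is the parent of [c]. As the two have the same ancestors apart from [c], the difference of
    the entries of a vector at [c] and [p] is its coordinate at the indicator of the subtree of
    [c]. *)
Lemma below_parent t o c : node t o c -> c != sroot t o ->
  exists p, [/\ node t o p, ~~ below t o c p &
    forall a, node t o a -> below t o a c = (a == c) || below t o a p].
Proof.
elim: t o => [|l IHl r IHr] o; first by rewrite /node /=; lia.
have nl p : node l o p -> node (Bin l r) o p /\ (p < o + ssize l)%N.
  by rewrite /node /=; lia.
have nr p : node r (o + ssize l).+1 p -> node (Bin l r) o p /\ (o + ssize l < p)%N.
  by rewrite /node /=; lia.
have rootn : node (Bin l r) o (o + ssize l) by rewrite /node /=; lia.
move=> hc; have nc := hc; move: hc.
case/nodeP => [[h lt]|->|[h gt]] /=; last 2 first.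
- by rewrite eqxx.
- move=> _; have [->|cr] := eqVneq c (sroot r (o + ssize l).+1).
    exists (o + ssize l)%N; split=> // [|a /nodeP[[ha la]|->|[ha ga]]].
    + rewrite below_r; last by have [] := nr _ (node_sroot h).
      by apply/negP => /(below_node (node_sroot h)); rewrite /node; lia.
    + rewrite !below_l //; apply/idP/idP => [|/orP[/eqP e|]].
      * by move/(below_node ha); have := node_sroot h; rewrite /node; lia.
      * by have := node_sroot h; rewrite /node; lia.
      by move/(below_node ha); rewrite /node; lia.
    + rewrite !below_root /= rootn orbT.
      by have [] := nr _ (node_sroot h).
    + rewrite !below_r //.
      have [->|ar] := eqVneq; first by rewrite (below_refl (node_sroot h)).
      rewrite /=; apply/idP/idP => b.
        have [le1 eq1] := below_size ha b.
        have [le2 eq2] := below_size (node_sroot h) (below_sroot ha).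
        by case/eqP: ar; apply: eq2; lia.
      by have := below_node ha b; rewrite /node; lia.
  have [p [hp cp pP]] := IHr _ h cr; exists p.
  split; [by have [] := nr _ hp | by rewrite below_r | move=> a].
  case/nodeP => [[ha la]|->|[ha ga]].
  + rewrite !below_l //; apply/idP/idP => [|/orP[/eqP e|]].
    * by move/(below_node ha); rewrite /node; lia.
    * lia.
    by move/(below_node ha); have [] := nr _ hp; rewrite /node; lia.
  + by rewrite !below_root nc; have [-> _] := nr _ hp; rewrite orbT.
  by rewrite !below_r // pP.
move=> _; have [->|cr] := eqVneq c (sroot l o).
  exists (o + ssize l)%N; split=> // [|a /nodeP[[ha la]|->|[ha ga]]].
  + rewrite below_l; last by have [] := nl _ (node_sroot h).
    by apply/negP => /(below_node (node_sroot h)); rewrite /node; lia.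
  + rewrite !below_l //.
    have [->|ar] := eqVneq; first by rewrite (below_refl (node_sroot h)).
    rewrite /=; apply/idP/idP => b.
      have [le1 eq1] := below_size ha b.
      have [le2 eq2] := below_size (node_sroot h) (below_sroot ha).
      by case/eqP: ar; apply: eq2; lia.
    by have := below_node ha b; rewrite /node; lia.
  + rewrite !below_root /= rootn orbT.
    by have [] := nl _ (node_sroot h).
  + rewrite !below_r //; apply/idP/idP => [|/orP[/eqP e|]].
    * by move/(below_node ha); have := node_sroot h; rewrite /node; lia.
    * by have := node_sroot h; rewrite /node; lia.
    by move/(below_node ha); rewrite /node; lia.
have [p [hp cp pP]] := IHl _ h cr; exists p.
split; [by have [] := nl _ hp | by rewrite below_l | move=> a].
case/nodeP => [[ha la]|->|[ha ga]].
+ by rewrite !below_l // pP.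
+ by rewrite !below_root nc; have [-> _] := nl _ hp; rewrite orbT.
rewrite !below_r //; apply/idP/idP => [|/orP[/eqP e|]].
* by move/(below_node ha); rewrite /node; lia.
* lia.
by move/(below_node ha); have [] := nl _ hp; rewrite /node; lia.
Qed.

Lemma below_trans t o a c j : node t o a ->
  below t o a c -> below t o c j -> below t o a j.
Proof.
elim: t o => [|l IHl r IHr] o; first by rewrite /node /=; lia.
move=> ha bac bcj; have hc := below_node ha bac; have hj := below_node hc bcj.
case/nodeP: ha bac => [[ha la]|->|[ha ga]]; last 2 first.
- by rewrite !below_root.
- rewrite !below_r // => bac; have nc := below_node ha bac.
  by move: bcj; rewrite below_r; [exact: IHr|move: nc; rewrite /node; lia].
rewrite !below_l // => bac; have nc := below_node ha bac.
by move: bcj; rewrite below_l; [exact: IHl|move: nc; rewrite /node; lia].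
Qed.

(** [k] is the lowest common ancestor. On the cone of the tree, the minimum over the interval is
    therefore always attained at this one position. *)
Lemma below_lca t o i j : node t o i -> node t o j -> (i <= j)%N ->
  exists k, [/\ node t o k, (i <= k <= j)%N & forall a, (i <= a <= j)%N -> below t o k a].
Proof.
elim: t o => [|l IHl r IHr] o; first by rewrite /node /=; lia.
move=> hi hj ij; case: (leqP (o + ssize l) j) => h1; last first.
  have [||k [hk ikj kP]] := IHl o _ _ ij; rewrite /node; [move: hi hj; rewrite /node /=; lia..|].
  exists k; split=> // [|a /kP]; first by move: hk; rewrite /node /=; lia.
  by rewrite below_l //; move: hk; rewrite /node; lia.
case: (leqP i (o + ssize l)) => h2.
  exists (o + ssize l)%N; split=> [||a]; first by rewrite /node /=; lia.
    by lia.
  by rewrite below_root; move: hi hj; rewrite /node /=; lia.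
have [||k [hk ikj kP]] := IHr (o + ssize l).+1 _ _ ij; rewrite /node; [move: hi hj; rewrite /node /=; lia..|].
exists k; split=> // [|a /kP]; first by move: hk; rewrite /node /=; lia.
by rewrite below_r //; lia.
Qed.

Lemma prod_nodes (R : comPzRingType) (G : nat * nat -> R) l r o :
  \prod_(o <= c < o + ssize (Bin l r) | c != (o + ssize l)%N) G (ivl (Bin l r) o c) =
  (\prod_(o <= c < o + ssize l) G (ivl l o c)) *
  \prod_((o + ssize l).+1 <= c < (o + ssize l).+1 + ssize r)
     G (ivl r (o + ssize l).+1 c).
Proof.
rewrite (big_cat_nat (n := (o + ssize l)%N)); [|rewrite /=; lia..]; congr (_ * _).
  rewrite big_nat_cond [RHS]big_nat; apply: eq_big => c; first by lia.
  by case/andP => /andP[_ h] _; rewrite ivl_l.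
rewrite big_ltn_cond; last by rewrite /=; lia.
rewrite ifF ?eqxx // (_ : (o + ssize (Bin l r) = (o + ssize l).+1 + ssize r)%N);
  last by rewrite /=; lia.
rewrite big_nat_cond [RHS]big_nat; apply: eq_big => c; first by lia.
by case/andP => h _; rewrite ivl_r //; lia.
Qed.

(** * Vectors increasing away from the root *)

Section Fits.
Variable R : realDomainType.

(** This is the cone C_t. Entries are indexed by [nat] so that a subtree, with its offset, refers to
    the same vector. *)
Definition fits t o (v : nat -> R) :=
  forall c j, node t o c -> below t o c j -> v c <= v j.

Lemma fitsP l r o v : fits (Bin l r) o v <->
  [/\ forall j, node (Bin l r) o j -> v (o + ssize l)%N <= v j,
      fits l o v & fits r (o + ssize l).+1 v].
Proof.
split=> [h|[h hl hr] c j].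
  split=> [j hj|c j hc b|c j hc b]; apply: h.
  - by rewrite /node /=; lia.
  - by rewrite below_root.
  - by move: hc; rewrite /node /=; lia.
  - by rewrite below_l //; move: hc; rewrite /node; lia.
  - by move: hc; rewrite /node /=; lia.
  by rewrite below_r //; move: hc; rewrite /node; lia.
case/nodeP => [[hc lt]|->|[hc gt]].
- by rewrite below_l //; apply: hl.
- by rewrite below_root; apply: h.
by rewrite below_r //; apply: hr.
Qed.

(** The Cartesian tree of [v]: its root is a position of the minimum, and both sides are treated
    alike. *)
Lemma fits_exists n o (v : nat -> R) : exists2 t, ssize t = n & fits t o v.
Proof.
elim/ltn_ind: n o => -[|n] IH o; first by exists Tip => // c j; rewrite /node /=; lia.
have [k kn kP] : exists2 k, (k < n.+1)%N &
    forall j, (j < n.+1)%N -> v (o + k)%N <= v (o + j)%N.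
  have [k _ kP] := @Order.TotalTheory.arg_minP _ _ _ (ord0 : 'I_n.+1) predT
    (fun k => v (o + k)%N) isT.
  by exists k => // j hj; apply: (kP (Ordinal hj)).
have [l sl fl] := IH k kn o.
have [|r sr fr] := IH (n - k)%N _ (o + k).+1; first by lia.
exists (Bin l r); first by rewrite /= sl sr; lia.
apply/fitsP; rewrite sl; split=> // j; rewrite /node /= sl sr => hj.
by rewrite -(subnKC (proj1 (andP hj))); apply: kP; lia.
Qed.

(** The root has to be a position of the minimum, and there is only one when the entries are
    distinct. *)
Lemma fits_unique t t' o (v : nat -> R) :
  (forall i j, node t o i -> node t o j -> v i = v j -> i = j) ->
  ssize t = ssize t' -> fits t o v -> fits t' o v -> t = t'.
Proof.
elim: t t' o => [|l IHl r IHr] [|l' r'] o //= vI [szE].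
move=> /fitsP[h hl hr] /fitsP[h' hl' hr'].
have sl : ssize l = ssize l'.
  suff : (o + ssize l = o + ssize l')%N by lia.
  apply: vI; rewrite /node /=; [lia..|apply/eqP].
  by rewrite eq_le h ?h' // /node /=; lia.
rewrite sl in hr; congr Bin.
- by apply: IHl hl hl' => // i j hi hj; apply: vI; move: hi hj; rewrite /node /=; lia.
apply: IHr hr hr' => [i j hi hj|]; last by lia.
by apply: vI; move: hi hj; rewrite /node /=; lia.
Qed.

End Fits.

(** * Indicators of subtrees as a unimodular basis *)

Section NodeMatrix.
Variable (R : realFieldType) (d : nat) (t : shape).
Hypothesis szt : ssize t = d.+1.

Definition nat_row (v : 'rV[R]_d.+1) (k : nat) : R := v 0 (inord k).

Definition node_mx : 'M[R]_d.+1 := \matrix_(c, k) (below t 0 c k)%:R.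

Let nodeI (c : 'I_d.+1) : node t 0 c.
Proof. by rewrite /node szt /= ltn_ord. Qed.

(** A permutation contributes only if it sends every node to one below it. Subtree sizes then weakly
    decrease while their sum is preserved, so the permutation is the identity. *)
Lemma det_node_mx : \det node_mx = 1.
Proof.
rewrite /determinant (bigD1 1%g) //= odd_perm1 mul1r [X in _ + X]big1 => [|s s1].
  by rewrite addr0 big1 // => c _; rewrite perm1 mxE below_refl.
apply/eqP; rewrite mulf_eq0; apply/orP; right; apply: contraNT s1 => /prodf_neq0 p0.
have b (c : 'I_d.+1) : below t 0 c (s c).
  by have := p0 c isT; rewrite mxE; case: below; rewrite ?eqxx.
have /leqif_sum : forall c : 'I_d.+1, true ->
    ((ivl t 0 (s c)).2 <= (ivl t 0 c).2 ?= iff (s c == c))%N.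
  move=> c _; have [le eq] := below_size (nodeI c) (b c); split=> //.
  by apply/eqP/eqP => [/eq/val_inj|->].
have eS : (\sum_(c < d.+1) (ivl t 0 (s c)).2 = \sum_(c < d.+1) (ivl t 0 c).2)%N.
  by rewrite [RHS](reindex_inj (@perm_inj _ s)).
rewrite eS => -[_]; rewrite eqxx => /esym/forallP sE.
by apply/eqP/permP => c; rewrite perm1; apply/eqP; exact: (sE c).
Qed.

Lemma node_mx_unit : node_mx \in unitmx.
Proof. by rewrite unitmxE det_node_mx unitr1. Qed.

Lemma node_mx_coord (v : 'rV[R]_d.+1) k :
  v 0 k = \sum_c (v *m invmx node_mx) 0 c * (below t 0 c k)%:R.
Proof.
rewrite -{1}(mulmxKV node_mx_unit v) mxE; apply: eq_bigr => c _.
by rewrite [node_mx c k]mxE.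
Qed.

(** The coordinate at a node other than the root is the increment of [v] from the parent. The root
    is exempt because its indicator is (1, ..., 1). *)
Lemma in_gcone_node_mx (v : 'rV[R]_d.+1) :
  reflect (fits t 0 (nat_row v)) (in_gcone node_mx [set inord (sroot t 0)] v).
Proof.
have lt_node c : node t 0 c -> (c < d.+1)%N by rewrite /node szt.
have rootE (c : 'I_d.+1) : (c \in [set inord (sroot t 0)]) = (val c == sroot t 0).
  by rewrite inE -val_eqE /= inordK // lt_node // (node_sroot (nodeI ord0)).
apply: (iffP forallP) => [y0 c j nc b|fv c].
  have nj := below_node nc b.
  rewrite /nat_row !node_mx_coord !inordK ?lt_node //; apply: ler_sum => a _.
  have [ac|ac] := boolP (below t 0 a c).
    by rewrite (below_trans (nodeI a) ac b).
  have [aj|//] := boolP (below t 0 a j).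
  rewrite mulr0 mulr1; have := y0 a; rewrite rootE; case: eqVneq => //= ar.
  by rewrite ar below_sroot in ac.
apply/implyP; rewrite rootE => cr.
have [p [np ncp pP]] := below_parent (nodeI c) cr.
have bpc : below t 0 p c by rewrite pP // (below_refl np) orbT.
have := fv p c np bpc; rewrite /nat_row inord_val -subr_ge0.
rewrite (node_mx_coord v c) (node_mx_coord v (inord p)) -sumrB.
rewrite (bigD1 c) //= inordK ?lt_node // (below_refl (nodeI c)) (negPf ncp).
rewrite mulr0 subr0 mulr1 big1 ?addr0 // => a ac.
by rewrite pP // val_eqE (negPf ac) subrr.
Qed.

End NodeMatrix.

(** * The boundary of the dual cone *)

Section Geometry.
Variables (R : realType) (d : nat).
Local Notation n := d.+1.
Implicit Types (v w : 'rV[R]_n) (p : index_pair n).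

Definition inside p : pred 'I_n := fun k => ((val p).1 <= k <= (val p).2)%N.

Lemma inside_fst p : inside p (val p).1.
Proof. by rewrite /inside leqnn (valP p). Qed.

Definition imin p v : R := v 0 [arg min_(k < (val p).1 | inside p k) v 0 k]%O.

Lemma imin_le p v k : inside p k -> imin p v <= v 0 k.
Proof.
by rewrite /imin; case: Order.TotalTheory.arg_minP => [|k' _ + /[dup] _]; [exact: inside_fst|exact].
Qed.

Lemma imin_attained p v : exists2 k, inside p k & imin p v = v 0 k.
Proof.
rewrite /imin; case: Order.TotalTheory.arg_minP => [|k pk _]; first exact: inside_fst.
by exists k.
Qed.

Lemma imin_eq p v k :
  inside p k -> (forall j, inside p j -> v 0 k <= v 0 j) -> imin p v = v 0 k.
Proof.
move=> pk kP; apply/eqP; rewrite eq_le imin_le //=.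
by have [j pj ->] := imin_attained p v; apply: kP.
Qed.

Lemma le_imin p v w : (forall k, v 0 k <= w 0 k) -> imin p v <= imin p w.
Proof.
move=> vw; have [k pk ->] := imin_attained p w.
exact: le_trans (imin_le _ pk) (vw k).
Qed.

Lemma imin_add_const p v c : imin p (v + const_mx c) = imin p v + c.
Proof.
have [k pk e] := imin_attained p v; rewrite (@imin_eq _ _ k) //.
  by rewrite !mxE e.
by move=> j pj; rewrite !mxE lerD2r -e imin_le.
Qed.

Lemma imin_sum p (I : finType) (f : I -> 'rV[R]_n) :
  \sum_i imin p (f i) <= imin p (\sum_i f i).
Proof.
have [k pk ->] := imin_attained p (\sum_i f i).
by rewrite summxE; apply: ler_sum => i _; apply: imin_le.
Qed.

Lemma dot_sumr (I : finType) (P : pred I) v (f : I -> 'rV[R]_n) (c : I -> R) :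
  dot v (\sum_(i | P i) c i *: f i) = \sum_(i | P i) c i * dot v (f i).
Proof.
rewrite /dot; under eq_bigr do rewrite summxE mulr_sumr.
rewrite exchange_big /=; apply: eq_bigr => i _; rewrite mulr_sumr.
by apply: eq_bigr => k _; rewrite mxE mulrCA.
Qed.

Lemma dot_delta v k : dot v (delta_mx 0 k) = v 0 k.
Proof.
rewrite /dot (bigD1 k) //= big1 => [|j jk]; rewrite mxE ?eqxx ?mulr1 ?addr0 //.
by rewrite (negPf jk) andbF mulr0.
Qed.

Lemma Delta_ge_imin p v y : Delta p y -> imin p v <= dot v y.
Proof.
case=> c [c0 c1 ->]; rewrite dot_sumr -[leLHS]mul1r -c1 mulr_suml.
by apply: ler_sum => k; rewrite inE dot_delta => pk; rewrite ler_wpM2l ?imin_le.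
Qed.

Lemma Delta_delta p k : inside p k -> Delta p (delta_mx 0 k : 'rV[R]_n).
Proof.
move=> pk; exists (fun j => (j == k)%:R); split=> [j||]; first by rewrite ler0n.
  by rewrite (bigD1 k) ?inE //= eqxx big1 ?addr0 // => j /andP[_ /negPf->].
rewrite (bigD1 k) ?inE //= eqxx scale1r big1 ?addr0 // => j /andP[_ /negPf->].
by rewrite scale0r.
Qed.

Lemma hfun_Delta p v : hfun (Delta p) v = - imin p v.
Proof.
have [k pk e] := imin_attained p v.
have mem : [set dot v y | y in Delta p]%classic (imin p v).
  by exists (delta_mx 0 k); rewrite ?dot_delta //; apply: Delta_delta.
have lb : lbound [set dot v y | y in Delta p]%classic (imin p v).
  by move=> _ [y py <-]; apply: Delta_ge_imin.
congr (- _); apply/eqP; rewrite eq_le; apply/andP; split.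
  by apply: ge_inf => //; exists (imin p v).
by apply: lb_le_inf => //; exists (imin p v).
Qed.

(** The function g, that is, minus the support function of the Minkowski sum. *)
Definition total_min v : R := \sum_p imin p v.

Lemma npairs_gt0 : 0 < #|index_pair n|%:R :> R.
Proof.
by rewrite ltr0n; apply/card_gt0P; exists (exist _ (ord0, ord0) (leqnn _)).
Qed.

Lemma total_min_add_const v c :
  total_min (v + const_mx c) = total_min v + c * #|index_pair n|%:R.
Proof.
rewrite /total_min; under eq_bigr do rewrite imin_add_const.
by rewrite big_split /= sumr_const mulr_natr.
Qed.

Lemma dual_cone_assoc v :
  dual_cone (cone (minkowski_sum (@Delta R n))) v <-> 0 <= total_min v.
Proof.
split=> [h|h _ [t [_ [t0 [q [qP ->]] ->]]]].
  have /fin_all_exists2[k kP ke] p := imin_attained p v.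
  have -> : total_min v = dot v (1 *: \sum_p delta_mx 0 (k p)).
    rewrite scaler_sumr dot_sumr; apply: eq_bigr => p _.
    by rewrite mul1r dot_delta ke.
  apply: h; exists 1, (\sum_p delta_mx 0 (k p)); split => //.
  by exists (fun p => delta_mx 0 (k p)); split=> // p; apply: Delta_delta.
have -> : dot v (t *: \sum_p q p) = t * \sum_p dot v (q p).
  by rewrite scaler_sumr dot_sumr mulr_sumr.
rewrite mulr_ge0 // (le_trans h) //; apply: ler_sum => p _.
exact: Delta_ge_imin.
Qed.

(** Monotonicity and the rule for adding constants make [total_min] Lipschitz. *)
Lemma ball_total_min v w e :
  ball v e w -> total_min v - e * #|index_pair n|%:R <= total_min w.
Proof.
move=> vw; rewrite -mulNr -total_min_add_const.
apply: ler_sum => p _; apply: le_imin => k; rewrite !mxE lerBlDr -lerBlDl.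
by case: vw => _ /(_ 0 k); rewrite /ball /= => /ltW; apply: le_trans; rewrite ler_norm.
Qed.

Lemma boundary_dual_cone_assoc v :
  boundary (dual_cone (cone (minkowski_sum (@Delta R n)))) v <-> total_min v = 0.
Proof.
have N0 := npairs_gt0; set N := _%:R in N0; split=> [[cl ni]|v0].
  apply/eqP; rewrite eq_le; apply/andP; split; rewrite leNgt; apply/negP => h.
    (* On this ball [total_min] stays nonnegative, so [v] would be interior. *)
    apply: ni; apply/nbhs_ballP; exists (total_min v / N) => /=; first by rewrite divr_gt0.
    move=> w /ball_total_min; rewrite divfK ?gt_eqF // subrr.
    by move/dual_cone_assoc.
  have e0 : 0 < - total_min v / 2 / N by rewrite !divr_gt0 ?oppr_gt0.
  have [w [/dual_cone_assoc w0 vw]] := cl _ (nbhsx_ballx v _ e0).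
  have := ball_total_min (ball_sym vw); rewrite divfK ?gt_eqF //.
  by move: h w0; lra.
split.
  apply: subset_closure; apply/dual_cone_assoc; by rewrite v0.
case/nbhs_ballP => e /= e0 sub.
(* Lowering all entries by e / 2 makes [total_min] negative. *)
have : ball v e (v + const_mx (- (e / 2))).
  split=> // i j; rewrite !mxE /ball /= opprD addNKr opprK gtr0_norm ?divr_gt0 //.
  by rewrite ltr_pdivrMr // ltr_pMr // ltr1n.
move/sub.
move=> /dual_cone_assoc; rewrite total_min_add_const v0 add0r mulNr oppr_ge0.
by rewrite leNgt mulr_gt0 ?divr_gt0.
Qed.

Lemma sconeP (F : d.-tuple 'rV[R]_n) y :
  @scone R n F y <-> exists2 c : 'I_d -> R, forall k, 0 <= c k & y = \sum_k c k *: tnth F k.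
Proof.
split=> [[c [c0 ->]]|[c c0 ->]]; exists c => //; [|split=> //];
  by apply: eq_bigl => k; rewrite inE.
Qed.

Lemma gens_mx_max (F : d.-tuple 'rV[R]_n) : row ord_max (@gens_mx R n F) = const_mx 1.
Proof.
by apply/rowP => j; rewrite !mxE nth_default ?mxE // size_tuple.
Qed.

Lemma gens_mx_lift (F : d.-tuple 'rV[R]_n) k :
  row (lift ord_max k) (@gens_mx R n F) = tnth F k.
Proof.
by apply/rowP => j; rewrite !mxE lift_max (tnth_nth (const_mx 1)).
Qed.

Lemma mul_gens_mx (F : d.-tuple 'rV[R]_n) (y : 'rV[R]_n) :
  y *m @gens_mx R n F =
  \sum_k y 0 (lift ord_max k) *: tnth F k + const_mx (y 0 ord_max).
Proof.
rewrite mulmx_sum_row (bigD1_ord ord_max) //= addrC gens_mx_max; congr (_ + _).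
  by apply: eq_bigr => k _; rewrite gens_mx_lift.
by apply/rowP => j; rewrite !mxE mulr1.
Qed.

(** * Simplicial cones contained in the boundary *)

Section Cell.
Variable F : d.-tuple 'rV[R]_n.
Hypothesis F0 : forall y, @scone R n F y -> total_min y = 0.

(** If (1, ..., 1) were a combination of the generators, moving the negative terms to the other side
    would give two points of the cone differing by (1, ..., 1). But [total_min] vanishes at both,
    and this shift increases it. *)
Lemma gens_mx_unit : free F -> @gens_mx R n F \in unitmx.
Proof.
move=> fF; rewrite -row_free_unit -kermx_eq0; apply/rowV0P => x /sub_kermxP.
rewrite mul_gens_mx => x0.
have xm : x 0 ord_max = 0.
  apply/eqP; apply: contraT => xm; pose z k := - x 0 (lift ord_max k) / x 0 ord_max.
  have z1 : \sum_k z k *: tnth F k = const_mx 1.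
    move/eqP: x0; rewrite addr_eq0 => /eqP x0.
    apply: (scalerI xm); rewrite scaler_sumr; apply/rowP => j.
    have /rowP/(_ j) := x0; rewrite summxE !mxE mulr1 => /eqP; rewrite -eqr_oppLR.
    rewrite -sumrN summxE => /eqP xmE; rewrite -[RHS]xmE; apply: eq_bigr => k _; rewrite !mxE /z.
    by field.
  pose s e := \sum_k (if 0 <= e * z k then `|z k| else 0) *: tnth F k.
  have s0 e : total_min (s e) = 0.
    by apply: F0; apply/sconeP; exists (fun k => if 0 <= e * z k then `|z k| else 0) => // k;
      case: ifP.
  have : s 1 = s (-1) + const_mx 1.
    rewrite -z1 -big_split; apply: eq_bigr => k _ /=; rewrite -scalerDl; congr (_ *: _).
    rewrite mul1r mulN1r oppr_ge0; case: (ltgtP (z k) 0) => zk.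
    + by rewrite ltr0_norm // addNr.
    + by rewrite gtr0_norm // add0r.
    by rewrite zk normr0 addr0.
  move/(congr1 total_min); rewrite total_min_add_const !s0 add0r mul1r => /eqP.
  by rewrite lt_eqF ?npairs_gt0.
apply/rowP => j; rewrite mxE; case: (unliftP ord_max j) => [k ->|->] //.
have /freeP := fF => /(_ (fun k => x 0 (lift ord_max k))); apply.
rewrite -[RHS]x0 xm (_ : const_mx 0 = 0) ?addr0; last by apply/rowP => i; rewrite !mxE.
by apply: eq_bigr => i _; rewrite (tnth_nth 0).
Qed.

Lemma cell_fits : exists2 t, ssize t = n &
  forall y, @scone R n F y -> fits t 0 (nat_row y).
Proof.
(* The sum of the generators selects the tree. Each interval minimum is superadditive, and equality
   holds at this sum because the totals on both sides are 0. *)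
pose y := \sum_k tnth F k.
have y0 : total_min y = 0.
  by apply: F0; apply/sconeP; exists (fun=> 1) => //; apply: eq_bigr => k _; rewrite scale1r.
have [t szt ft] := fits_exists n 0 (nat_row y); exists t => //.
have eF p : imin p y = \sum_k imin p (tnth F k).
  apply/eqP; rewrite eq_sym; move: p.
  have le p : \sum_k imin p (tnth F k) <= imin p y ?= iff
      (\sum_k imin p (tnth F k) == imin p y) by split=> //; apply: imin_sum.
  have [_] := leif_sum (fun p (_ : true) => le p).
  have -> : \sum_p \sum_k imin p (tnth F k) = \sum_p imin p y.
    rewrite exchange_big /= -/(total_min y) y0 big1 // => k _; apply: F0.
    apply/sconeP; exists (fun j => (j == k)%:R); first by move=> j; rewrite ler0n.
    rewrite (bigD1 k) //= eqxx scale1r big1 ?addr0 // => j /negPf->.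
    by rewrite scale0r.
  by rewrite eqxx => /esym/forallP h p; apply: h.
have fF k : fits t 0 (nat_row (tnth F k)).
  move=> c j nc b; have nj := below_node nc b.
  have [cn jn] : (c < n)%N /\ (j < n)%N by move: nc nj; rewrite /node szt; lia.
  have mM : ((inord (minn c j) : 'I_n) <= (inord (maxn c j) : 'I_n))%N by rewrite !inordK; lia.
  (* All positions between [c] and [j] are below [c], so [y] has its minimum over them at [c];
     additivity passes this on to every generator. *)
  pose p : index_pair n := exist _ (inord (minn c j), inord (maxn c j)) mM.
  have insE (i : 'I_n) : inside p i = (minn c j <= i <= maxn c j)%N.
    by rewrite /inside /= !inordK; lia.
  have pc : inside p (inord c) by rewrite insE inordK; lia.
  have pj : inside p (inord j) by rewrite insE inordK; lia.
  have yc : imin p y = y 0 (inord c).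
    apply: imin_eq => // i; rewrite insE => hi.
    have bi : below t 0 c i by have := below_refl nc; move: b hi; rewrite /below; lia.
    by have := ft _ _ nc bi; rewrite /nat_row inord_val.
  have := eF p; rewrite yc /y summxE => /eqP; rewrite -subr_eq0 -sumrB.
  rewrite psumr_eq0 => [/allP/(_ k)|i _]; last by rewrite subr_ge0 imin_le.
  rewrite mem_index_enum subr_eq0 => /(_ isT)/eqP h.
  by rewrite /nat_row h imin_le.
move=> _ /sconeP[c c0 ->] i j ni b; rewrite /nat_row !summxE; apply: ler_sum => k _.
by rewrite !mxE ler_wpM2l //; apply: fF.
Qed.

Lemma scone_gens_coord (y : 'rV[R]_n) (c : 'I_d -> R) e : @gens_mx R n F \in unitmx ->
  y - const_mx e = \sum_k c k *: tnth F k ->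
  forall k, (y *m invmx (@gens_mx R n F)) 0 (lift ord_max k) = c k.
Proof.
move=> u /eqP; rewrite subr_eq => /eqP ye k.
pose z : 'rV[R]_n := \row_i (if unlift ord_max i is Some k then c k else e).
have -> : y = z *m @gens_mx R n F.
  rewrite mul_gens_mx ye mxE unlift_none; congr (_ + _).
  by apply: eq_bigr => i _; rewrite mxE liftK.
by rewrite mulmxK // mxE liftK.
Qed.

(** Allowing both signs for the last row adds the line R(1, ..., 1) to the cell, which gives it full
    dimension. *)
Lemma in_gcone_gens (y : 'rV[R]_n) : @gens_mx R n F \in unitmx ->
  in_gcone (@gens_mx R n F) [set ord_max] y <->
  exists e, @scone R n F (y - const_mx e).
Proof.
move=> u; split=> [/forallP h|[e /sconeP[c c0 ye]]].
  pose x := y *m invmx (@gens_mx R n F); exists (x 0 ord_max); apply/sconeP.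
  exists (fun k => x 0 (lift ord_max k)).
    by move=> k; have := h (lift ord_max k); rewrite inE eq_sym neq_lift.
  by rewrite -{1}[y](mulmxKV u) -/x mul_gens_mx addrK.
apply/forallP => i; rewrite inE; case: (unliftP ord_max i) => [k ->|->]; last by rewrite eqxx.
by rewrite (scone_gens_coord u ye) c0 implybT.
Qed.

End Cell.

Lemma fits_imin_linear t : ssize t = n -> exists k : index_pair n -> 'I_n,
  forall v, fits t 0 (nat_row v) -> forall p, imin p v = v 0 (k p).
Proof.
move=> szt; have nodeI (i : 'I_n) : node t 0 i by rewrite /node szt /= ltn_ord.
have /fin_all_exists[k kP] p : exists k : 'I_n,
    inside p k /\ forall a, inside p a -> below t 0 k a.
  have [k [nk pk kP]] := below_lca (nodeI (val p).1) (nodeI (val p).2) (valP p).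
  have kn : (k < n)%N by move: nk; rewrite /node szt.
  by exists (Ordinal kn); split=> // a; apply: kP.
exists k => v fv p; have [pk kb] := kP p; apply: imin_eq => // j /kb b.
by have := fv _ _ (nodeI (k p)) b; rewrite /nat_row !inord_val.
Qed.

(** * Comparison of a triangulation with the cones of trees *)

Variable x : index_pair n -> R.
Hypothesis sum_x : \sum_p x p = 0.

Local Notation denom v := (dmv_denom (@Delta R n) x 0 v).

Lemma dmv_denom_Delta v : denom v = - \sum_p x p * imin p v.
Proof.
rewrite /dmv_denom [dot v 0]big1 ?addr0 => [|k _]; last by rewrite mxE mulr0.
by rewrite -sumrN; apply: eq_bigr => p _; rewrite hfun_Delta mulrN.
Qed.

Lemma dmv_denom_linear t : ssize t = n -> exists l : 'cV[R]_n,
  forall v, fits t 0 (nat_row v) -> (v *m l) 0 0 = denom v.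
Proof.
move=> /fits_imin_linear[k kP].
exists (- \sum_p x p *: delta_mx (k p) 0) => v fv.
rewrite dmv_denom_Delta mulmxN mxE mulmx_sumr summxE; congr (- _).
by apply: eq_bigr => p _; rewrite -scalemxAr -colE !mxE (kP v fv).
Qed.

Lemma node_mx_fits t c : ssize t = n -> fits t 0 (nat_row (row c (node_mx R d t))).
Proof.
move=> szt; have nodeI (i : 'I_n) : node t 0 i by rewrite /node szt /= ltn_ord.
have lt_n i : node t 0 i -> (i < n)%N by rewrite /node szt.
move=> a j na b; rewrite /nat_row !mxE !inordK ?lt_n //; last exact: below_node b.
have [ca|//] := boolP (below t 0 c a).
by rewrite (below_trans (nodeI c) ca b).
Qed.

(** A subtree is an interval of nodes, so the minimum of its indicator over [i,j] is 1 if both ends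
    lie in it and 0 otherwise. *)
Lemma denom_node_mx t c : ssize t = n ->
  denom (row c (node_mx R d t)) =
  - \sum_(p : index_pair n | below t 0 c (val p).1 && below t 0 c (val p).2) x p.
Proof.
move=> szt; rewrite dmv_denom_Delta [in RHS]big_mkcond; congr (- _).
apply: eq_bigr => p _; have p12 := valP p.
have rowE k : row c (node_mx R d t) 0 k = (below t 0 c k)%:R by rewrite !mxE.
case: ifPn => [/andP[b1 b2]|nb].
  rewrite (@imin_eq _ _ (val p).1) ?inside_fst // => [|j pj]; rewrite rowE b1 ?mulr1 //.
  have bj : below t 0 c j by move: b1 b2 pj; rewrite /below /inside; lia.
  by rewrite rowE bj.
have [k pk nk] : exists2 k : 'I_n, inside p k & ~~ below t 0 c k.
  case/nandP: nb => nb; [exists (val p).1|exists (val p).2] => //.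
    exact: inside_fst.
  by rewrite /inside leqnn (valP p).
by rewrite (@imin_eq _ _ k) // rowE (negPf nk) ?mulr0 // => j _; rewrite rowE ler0n.
Qed.

(** The germ at a generator that spans a line amounts to the quotient by this line. For the row (1,
    ..., 1) of [gens_mx] the weight is a summand of the dual mixed volume. *)
Lemma germ_weight_row m (B : 'M[R]_m) r l : B \in unitmx ->
  germ_weight (row r B) B [set r] l = `|\det B| / \prod_(j | j != r) (B *m l) j 0.
Proof.
move=> uB; rewrite /germ_weight -row_mul mulmxV //.
have rE j : row r (1%:M : 'M[R]_m) 0 j = (r == j)%:R by rewrite !mxE.
rewrite (bigD1 r) //= [X in _ + X]big1 ?addr0 => [|k kr].
  have -> : [forall j, (j != r) ==> (row r (1%:M : 'M[R]_m) 0 j == 0)].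
    by apply/forallP => j; rewrite rE eq_sym; apply/implyP => /negPf->.
  by rewrite subxx inE eqxx orbT rE eqxx normr1 mulr1.
by rewrite finset.sub1set inE (eq_sym r) (negPf kr).
Qed.

Lemma prod_gens_mx (F : d.-tuple 'rV[R]_n) (l : 'cV[R]_n) :
  \prod_(j | j != ord_max) (@gens_mx R n F *m l) j 0 =
  \prod_k (tnth F k *m l) 0 0.
Proof.
rewrite (reindex_omap (lift ord_max) (unlift ord_max)) /=; last first.
  by move=> j; case: (unliftP ord_max j) => [k ->|->] //; rewrite eqxx.
apply: eq_big => k; first by rewrite liftK eqxx eq_sym neq_lift.
by move=> _; rewrite -gens_mx_lift -row_mul [RHS]mxE.
Qed.

(** For each tree t, the cells inside C_t, enlarged by R(1, ..., 1), cover C_t exactly once at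
    generic points. The germ of this relation at (1, ..., 1) gives the term of t. *)
Lemma dual_mixed_volume_trees m (T : 'I_m -> n.-1.-tuple 'rV[R]_n) :
  dmv_triangulation (@Delta R n) T -> dmv_regular (@Delta R n) T x 0 ->
  (forall t (c : 'I_n), ssize t = n -> c != sroot t 0 :> nat ->
     denom (row c (node_mx R d t)) != 0) ->
  dual_mixed_volume (@Delta R n) T x 0 =
  \sum_(t <- shapes n) \prod_(c < n | c != sroot t 0 :> nat)
     (denom (row c (node_mx R d t)))^-1.
Proof.
move=> [free_T cover_T meet_T] regT regC.
have total_T a y : scone (T a) y -> total_min y = 0.
  move=> Ty; apply/boundary_dual_cone_assoc; rewrite -cover_T.
  by exists a.
have uT a : @gens_mx R n (T a) \in unitmx by apply: gens_mx_unit (free_T a); apply: total_T.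
have /fin_all_exists[tau tauP] a : exists t, ssize t = n /\
    forall y, scone (T a) y -> fits t 0 (nat_row y).
  by have [t szt tP] := cell_fits (@total_T a); exists t.
(* The walls of the enlarged cells, and the hyperplanes y_i = y_j, off which only one tree fits
   [y]. *)
pose H : seq 'cV[R]_n :=
  [seq col (lift ord_max aj.2) (invmx (@gens_mx R n (T aj.1))) | aj : 'I_m * 'I_d] ++
  [seq delta_mx ij.1 0 - delta_mx ij.2 0 | ij <- enum {: 'I_n * 'I_n} & ij.1 != ij.2].
have H0 : 0 \notin H.
  rewrite mem_cat negb_or; apply/andP; split.
    apply/fintype.imageP => -[[a j] _ /= /esym/eqP]; apply/negP.
    apply: contraTneq (uT a) => c0.
    rewrite -unitmx_inv -unitmx_tr -row_free_unit -kermx_eq0.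
    apply/rowV0Pn; exists (delta_mx 0 (lift ord_max j)); last first.
      by apply/eqP => /rowP/(_ (lift ord_max j)); rewrite !mxE !eqxx => /eqP; rewrite oner_eq0.
    by apply/sub_kermxP; rewrite -rowE -tr_col c0 trmx0.
  apply/mapP => -[[i j]]; rewrite mem_filter /= => /andP[ij _].
  move/colP/(_ i)/eqP; rewrite !mxE !eqxx (negPf ij) /= subr0 eq_sym.
  by rewrite oner_eq0.
have generic (y : 'rV[R]_n) : (forall h, h \in H -> (y *m h) 0 0 != 0) ->
    exists2 a0, forall a, in_gcone (@gens_mx R n (T a)) [set ord_max] y = (a == a0)
      & forall t, ssize t = n -> fits t 0 (nat_row y) <-> tau a0 = t.
  (* [e] is the only shift along (1, ..., 1) that carries [y] into the boundary. *)
  move=> gy; pose e := total_min y / #|index_pair n|%:R.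
  have eE e' : (total_min (y - const_mx e') = 0) -> e' = e.
    rewrite (_ : - const_mx e' = const_mx (- e')); last by apply/rowP => j; rewrite !mxE.
    rewrite total_min_add_const mulNr => /eqP; rewrite subr_eq0 => /eqP ye.
    by rewrite /e ye mulfK // gt_eqF ?npairs_gt0.
  have e0 : total_min (y - const_mx e) = 0.
    rewrite (_ : - const_mx e = const_mx (- e)); last by apply/rowP => j; rewrite !mxE.
    by rewrite total_min_add_const mulNr divfK ?subrr // gt_eqF ?npairs_gt0.
  have inT a : in_gcone (@gens_mx R n (T a)) [set ord_max] y <->
      scone (T a) (y - const_mx e).
    rewrite (in_gcone_gens _ (uT a)); split=> [[e' h]|h]; last by exists e.
    by rewrite -(eE e') // (total_T a).
  have coord_ne a k : (y *m invmx (@gens_mx R n (T a))) 0 (lift ord_max k) != 0.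
    have := gy (col (lift ord_max k) (invmx (@gens_mx R n (T a)))).
    have -> M j : (y *m col j (M : 'M[R]_n)) 0 0 = (y *m M) 0 j.
      by rewrite colE mulmxA -colE mxE.
    apply.
    by rewrite mem_cat; apply/orP; left; apply/fintype.imageP; exists (a, k).
  (* A generic point has no zero coordinate and lies in no proper face, so two cells containing it
     would coincide. *)
  have face_full a (J : {set 'I_d}) : face (T a) J (y - const_mx e) -> J = [set: 'I_d].
    case=> c [c0 yc]; apply/finset.setP => k; rewrite inE; apply: contraT => kJ.
    have := coord_ne a k.
    rewrite (@scone_gens_coord (T a) y (fun k => if k \in J then c k else 0) e) //.
      by rewrite (negPf kJ) eqxx.
    rewrite yc big_mkcond; apply: eq_bigr => i _.
    by case: ifP => //; rewrite scale0r.
  have [a0 _ ya0] : (\bigcup_a scone (T a))%classic (y - const_mx e).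
    by rewrite cover_T; apply/boundary_dual_cone_assoc.
  exists a0 => [a|t szt].
    apply/idP/eqP => [/inT ya|->]; last exact/inT.
    apply/eqP; apply: contraT => aa0.
    have [neq [J [K [IJ JK]]]] := meet_T _ _ aa0.
    have yJ : face (T a) J (y - const_mx e) by rewrite -IJ; split.
    have yK : face (T a0) K (y - const_mx e) by rewrite -JK.
    by case: neq; move: JK; rewrite (face_full _ _ yJ) (face_full _ _ yK).
  have shiftE : nat_row (y - const_mx e) =1 (fun k => nat_row y k - e).
    by move=> k; rewrite /nat_row !mxE.
  have fit0 : fits (tau a0) 0 (nat_row y).
    move=> i j ni b; have := (tauP a0).2 _ ya0 i j ni b.
    by rewrite !shiftE lerD2r.
  split=> [ft|<-//]; apply: (fits_unique _ _ fit0 ft); last by rewrite szt (tauP a0).1.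
  rewrite /node (tauP a0).1 => i j /= ni nj yij; apply/eqP; apply: contraT => ij.
  have := gy (delta_mx (inord i) 0 - delta_mx (inord j) 0).
  rewrite mulmxBr -!colE !mxE -/(nat_row y i) -/(nat_row y j) yij subrr eqxx.
  apply; rewrite mem_cat; apply/orP; right.
  apply/mapP; exists (inord i, inord j) => //; rewrite mem_filter mem_enum andbT /=.
  by rewrite -val_eqE /= !inordK.
rewrite /dual_mixed_volume.
transitivity (\sum_(t <- shapes n) \sum_(a < m | tau a == t)
    `|\det (gens_mx (T a))| / \prod_(k < d) denom (tnth (T a) k)).
  rewrite (exchange_big_dep predT) //=; apply: eq_bigr => a _.
  rewrite -[RHS]big_filter [RHS](bigD1_seq (tau a)) ?filter_uniq ?shapes_uniq //=; last first.
    by rewrite mem_filter eqxx mem_shapes (tauP a).1 /=.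
  rewrite [X in _ + X]big_filter_cond [X in _ + X]big1 ?addr0 // => t.
  by case/andP => /eqP->; rewrite eqxx.
apply: eq_big_seq => t; rewrite mem_shapes => /eqP szt.
have [l lP] := dmv_denom_linear szt.
pose r : 'I_n := inord (sroot t 0).
have rE (c : 'I_n) : (c != r) = (c != sroot t 0 :> nat).
  rewrite -val_eqE /= inordK //.
  have : node t 0 (sroot t 0) by apply: (@node_sroot _ _ 0); rewrite /node szt.
  by rewrite /node szt.
(* [None] stands for C_t with coefficient -1. Cells of other trees get coefficient 0 and a copy of
   [node_mx], so that the conditions on the matrices hold for every index. *)
pose w (o : option 'I_m) : R := if o is Some a then (tau a == t)%:R else -1.
pose B (o : option 'I_m) : 'M[R]_n :=
  if o is Some a then if tau a == t then gens_mx (T a) else node_mx R d t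
  else node_mx R d t.
pose r' (o : option 'I_m) : 'I_n :=
  if o is Some a then if tau a == t then ord_max else r else r.
have rowB o : row (r' o) (B o) = const_mx 1.
  have rowr : row r (node_mx R d t) = const_mx 1.
    apply/rowP => j; rewrite !mxE inordK; last first.
      have : node t 0 (sroot t 0) by apply: (@node_sroot _ _ 0); rewrite /node szt.
      by rewrite /node szt.
    by rewrite below_sroot // /node szt /=.
  by case: o => [a|] //=; case: ifP => // _; rewrite gens_mx_max.
have uB o : B o \in unitmx.
  by case: o => [a|] /=; [case: ifP|]; rewrite ?node_mx_unit.
have gz : generically_zero w B (fun o => [set r' o]).
  exists H => // y /generic[a0 a0P tP].
  have gE : in_gcone (node_mx R d t) [set r] y = (tau a0 == t).
    by apply/(in_gcone_node_mx szt)/eqP => /(tP _ szt).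
  rewrite (bigD1 None) //= gE (reindex_omap Some id) /=; last by case.
  rewrite (bigD1 a0) //= big1 => [|a /andP[_ aa0]]; last first.
    case: ifP => _ /=; last by rewrite mul0rn.
    by rewrite a0P (negPf aa0).
  case: ifP => ta0; rewrite ?mulr0n ?mul0rn ?addr0 //.
  by rewrite a0P eqxx !mulr1n addNr.
have fits1 : fits t 0 (nat_row (const_mx 1 : 'rV[R]_n)).
  by move=> i j _ _; rewrite /nat_row !mxE.
(* The restriction to the hyperplane enters here: [l] has to vanish at the vector whose germ is
   taken. *)
have l1 : ((const_mx 1 : 'rV[R]_n) *m l) 0 0 = 0.
  rewrite lP // dmv_denom_Delta (eq_bigr x) ?sum_x ?oppr0 // => p _.
  have [k _ ->] := imin_attained p (const_mx 1); by rewrite mxE mulr1.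
have fitsT a k : tau a = t -> fits t 0 (nat_row (tnth (T a) k)).
  move=> <-; apply: (tauP a).2; apply/sconeP; exists (fun j => (j == k)%:R).
    by move=> j; rewrite ler0n.
  by rewrite (bigD1 k) //= eqxx scale1r big1 ?addr0 // => j /negPf->; rewrite scale0r.
have nodeE c : (node_mx R d t *m l) c 0 = denom (row c (node_mx R d t)).
  by rewrite -lP; [rewrite -row_mul [RHS]mxE|apply: node_mx_fits].
have Bl o j : j != r' o -> (B o *m l) j 0 != 0.
  have nodel : j != r -> (node_mx R d t *m l) j 0 != 0.
    by rewrite rE nodeE; apply: regC.
  case: o => [a|] //=; case: ifP => [/eqP ta|] //.
  case: (unliftP ord_max j) => [k ->|->]; last by rewrite eqxx.
  move=> _; have -> : (@gens_mx R n (T a) *m l) (lift ord_max k) 0 = (tnth (T a) k *m l) 0 0.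
    by rewrite -gens_mx_lift -row_mul [RHS]mxE.
  by rewrite lP; [exact: regT|exact: fitsT].
have v1 : const_mx 1 != 0 :> 'rV[R]_n.
  by apply/eqP => /rowP/(_ 0); rewrite !mxE => /eqP; rewrite oner_eq0.
have := germ_weights_cancel (@cone_weights_cancel R d) uB gz v1 l1.
have hB o j k : j != k -> ((const_mx 1 : 'rV[R]_n) *m invmx (B o)) 0 k != 0 -> (B o *m l) j 0 != 0.
  rewrite -(rowB o) -row_mul mulmxV // [row _ _ 0 k]mxE [1%:M _ _]mxE.
  case: (eqVneq (r' o) k) => [<- jk _|_ _ /eqP[]//].
  exact: Bl.
move=> /(_ hB).
under eq_bigr => o _ do rewrite -(rowB o) germ_weight_row //.
rewrite (bigD1 None) //= (reindex_omap Some id) /=; last by case.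
rewrite det_node_mx // normr1 mulN1r div1r => /eqP; rewrite addrC subr_eq0 => /eqP sE.
transitivity ((\prod_(j | j != r) (node_mx R d t *m l) j 0)^-1); last first.
  by rewrite -prodfV; apply: eq_big => c; rewrite ?rE // => _; rewrite nodeE.
rewrite -sE [LHS]big_mkcond; apply: eq_big => [a|a _]; first by rewrite eqxx.
case: ifP => [/eqP ta|_]; last by rewrite mul0r.
rewrite mul1r prod_gens_mx; congr (_ / _); apply: eq_bigr => k _.
by rewrite lP //; apply: fitsT.
Qed.

End Geometry.

(** * Labelled binary trees and planar cubic trees *)

Inductive ltree (V : Type) := LLeaf of V | LNode of V & ltree V & ltree V.

Lemma ltree_comparable (V : eqType) : comparable (ltree V).
Proof.
have dV (x y : V) : {x = y} + {x <> y} by exact: (decP eqP).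
by move=> x y; rewrite /decidable; decide equality.
Qed.

HB.instance Definition _ (V : eqType) :=
  hasDecEq.Build (ltree V) (compareP (@ltree_comparable V)).

Section LabelledTrees.
Variable V : eqType.
Implicit Types (b : ltree V) (u v w : V).

Definition top b := match b with LLeaf v => v | LNode v _ _ => v end.

Fixpoint shape_of b := if b is LNode _ l r then Bin (shape_of l) (shape_of r) else Tip.

Fixpoint verts b := if b is LNode v l r then v :: verts l ++ verts r else [:: top b].

Fixpoint leaves b := if b is LNode _ l r then leaves l ++ leaves r else [:: top b].

Fixpoint inners b := if b is LNode v l r then v :: inners l ++ inners r else [::].

(* The subtrees of [b], each with the label of its parent; [u] is the parent
   of [b] itself. *)
Fixpoint subs u b : seq (V * ltree V) :=
  (u, b) :: if b is LNode v l r then subs v l ++ subs v r else [::].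

(* [(v, x, y)] stands for: y follows x in the cyclic order around v. *)
Definition star (p : V * ltree V) : seq (V * V * V) :=
  match p with
  | (u, LLeaf v) => [:: (v, u, u)]
  | (u, LNode v l r) => [:: (v, u, top l); (v, top l, top r); (v, top r, u)]
  end.

Definition stars u b := flatten [seq star p | p <- subs u b].

(** Adds the rotation at the outer vertex [u], a leaf whose only neighbour is [top b]. *)
Definition planted u b := (u, top b, top b) :: stars u b.

Lemma size_verts b : size (verts b) = (ssize (shape_of b)).*2.+1.
Proof. by elim: b => //= v l IHl r IHr; rewrite size_cat IHl IHr; lia. Qed.

Lemma size_leaves b : size (leaves b) = (ssize (shape_of b)).+1.
Proof. by elim: b => //= v l IHl r IHr; rewrite size_cat IHl IHr; lia. Qed.

Lemma size_inners b : size (inners b) = ssize (shape_of b).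
Proof. by elim: b => //= v l IHl r IHr; rewrite size_cat IHl IHr; lia. Qed.

Lemma top_verts b : top b \in verts b.
Proof. by case: b => [v|v l r] /=; rewrite mem_head. Qed.

Lemma perm_verts b : perm_eq (verts b) (leaves b ++ inners b).
Proof.
apply/seq.permP => a; elim: b => [v|v l IHl r IHr] /=; first by rewrite addn0.
by rewrite !count_cat /= !count_cat IHl IHr !count_cat; lia.
Qed.

Lemma subs_verts u b : [seq top p.2 | p <- subs u b] = verts b.
Proof. by elim: b u => //= v l IHl r IHr u; rewrite map_cat IHl IHr. Qed.

Lemma subs_mem u b : (u, b) \in subs u b.
Proof. by case: b => *; rewrite mem_head. Qed.

Lemma verts_subs u b x : x \in verts b -> exists2 p, p \in subs u b & top p.2 = x.
Proof. by rewrite -(subs_verts u) => /mapP[p pb ->]; exists p. Qed.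

Lemma subs_trans u b p : p \in subs u b -> {subset subs p.1 p.2 <= subs u b}.
Proof.
elim: b u => [v|v l IHl r IHr] u /=; first by rewrite inE => /eqP->.
rewrite inE => /orP[/eqP-> //|]; rewrite mem_cat => /orP[/IHl|/IHr] h q /h.
- by rewrite inE mem_cat => ->; rewrite orbT.
- by rewrite inE mem_cat => ->; rewrite !orbT.
Qed.

Lemma subs_top u b p : p \in subs u b -> top p.2 \in verts b.
Proof. by move=> pb; rewrite -(subs_verts u); apply: map_f. Qed.

Lemma subs_verts_sub u b p : p \in subs u b -> {subset verts p.2 <= verts b}.
Proof.
by move=> /subs_trans h x /(verts_subs p.1)[q /h qb <-]; apply: subs_top qb.
Qed.

Lemma subs_left u b w v l r : (w, LNode v l r) \in subs u b -> (v, l) \in subs u b.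
Proof. by move/subs_trans; apply; rewrite /= inE mem_cat subs_mem orbT. Qed.

Lemma subs_right u b w v l r : (w, LNode v l r) \in subs u b -> (v, r) \in subs u b.
Proof. by move/subs_trans; apply; rewrite /= inE mem_cat subs_mem !orbT. Qed.

Lemma subs_parent u b p : p \in subs u b -> p = (u, b) \/
  exists w l r, (w, LNode p.1 l r) \in subs u b /\ (p.2 = l \/ p.2 = r).
Proof.
elim: b u p => [v|v l IHl r IHr] u p /=; first by rewrite inE => /eqP; left.
rewrite inE => /orP[/eqP|]; first by left.
rewrite mem_cat => /orP[/IHl|/IHr] [->|[w [l' [r' [h e]]]]]; right.
- by exists u, l, r; rewrite inE eqxx; split=> //; left.
- by exists w, l', r'; rewrite inE mem_cat h orbT.
- by exists u, l, r; rewrite inE eqxx; split=> //; right.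
- by exists w, l', r'; rewrite inE mem_cat h !orbT.
Qed.

Lemma subs_parent_mem u b p : p \in subs u b -> p.1 \in u :: verts b.
Proof.
move=> /subs_parent[->|[w [l [r [h _]]]]]; first exact: mem_head.
by rewrite inE (subs_top h) orbT.
Qed.

Lemma subs_uniq u b p : uniq (u :: verts b) -> p \in subs u b -> uniq (p.1 :: verts p.2).
Proof.
elim: b u => [v|v l IHl r IHr] u ub; first by rewrite inE => /eqP->.
have /and4P[_ vlr ul /andP[_ ur]] : [&& u \notin verts (LNode v l r),
    v \notin verts l ++ verts r, uniq (verts l) &
    ~~ has (mem (verts l)) (verts r) && uniq (verts r)].
  by move: ub; rewrite /= cat_uniq.
move: vlr; rewrite mem_cat negb_or => /andP[vl vr].
rewrite /= inE mem_cat => /or3P[/eqP-> //|pl|pr].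
  by apply: IHl pl; rewrite /= vl.
by apply: IHr pr; rewrite /= vr.
Qed.

Lemma subs_inj u b p q : uniq (verts b) -> p \in subs u b -> q \in subs u b ->
  top p.2 = top q.2 -> p = q.
Proof.
rewrite -(subs_verts u); elim: (subs u b) => //= p0 s IH /andP[p0s us].
rewrite !inE => /orP[/eqP->|ps] /orP[/eqP->|qs] // e; last exact: IH.
- by case/negP: p0s; rewrite e; apply: (map_f (fun p => top p.2)) qs.
- by case/negP: p0s; rewrite -e; apply: (map_f (fun p => top p.2)) ps.
Qed.

Lemma star_top p x : x \in star p -> x.1.1 = top p.2.
Proof.
by case: p => u [v|v l r]; rewrite !inE; [move/eqP->|case/or3P=> /eqP->].
Qed.

Lemma star_first p : exists w, (top p.2, p.1, w) \in star p.
Proof. by case: p => u [v|v l r]; [exists u|exists (top l)]; rewrite mem_head. Qed.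

Lemma starsP u b x : reflect (exists2 p, p \in subs u b & x \in star p) (x \in stars u b).
Proof. exact: flatten_mapP. Qed.

Lemma mem_stars u b p x : uniq (verts b) -> p \in subs u b -> x.1.1 = top p.2 ->
  (x \in stars u b) = (x \in star p).
Proof.
move=> ub pb xp; apply/starsP/idP => [[q qb xq]|xs]; last by exists p.
by rewrite -(subs_inj ub qb pb) // -(star_top xq).
Qed.

Lemma starsN u v l r : stars u (LNode v l r) =
  star (u, LNode v l r) ++ stars v l ++ stars v r.
Proof. by rewrite /stars /= map_cat flatten_cat. Qed.

Lemma stars_verts u b x : x \in stars u b -> x.1.1 \in verts b.
Proof. by case/starsP => p pb /star_top->; apply: subs_top pb. Qed.

Lemma mem_planted u b p x : uniq (u :: verts b) -> p \in subs u b -> x.1.1 = top p.2 ->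
  (x \in planted u b) = (x \in star p).
Proof.
move=> ub pb xp; rewrite inE (mem_stars _ pb) //; last by case/andP: ub.
case: eqP => // xu; case/andP: ub => /negP[].
by have := subs_top pb; rewrite -xp xu.
Qed.

Lemma planted_root u b x w : uniq (u :: verts b) ->
  ((u, x, w) \in planted u b) = ((x, w) == (top b, top b)).
Proof.
move=> /andP[ub _]; rewrite inE [_ \in stars _ _](_ : _ = false) ?orbF.
  by rewrite !xpair_eqE eqxx.
by apply: contraNF ub => /stars_verts.
Qed.

Lemma planted_sym u b x y w : (x, y, w) \in planted u b ->
  exists z, (y, x, z) \in planted u b.
Proof.
have child p : p \in subs u b -> exists z, (top p.2, p.1, z) \in planted u b.
  move=> pb; have [z h] := star_first p; exists z; rewrite inE.
  by apply/orP; right; apply/starsP; exists p.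
have parent p : p \in subs u b -> exists z, (p.1, top p.2, z) \in planted u b.
  move=> /subs_parent[->|[z [l [r [h e]]]]]; first by exists (top b); rewrite mem_head.
  have hs q : q \in star (z, LNode p.1 l r) -> q \in planted u b.
    by move=> qs; rewrite inE; apply/orP; right; apply/starsP; exists (z, LNode p.1 l r).
  case: e => ->; [exists (top r)|exists z]; apply: hs.
    by rewrite !inE eqxx orbT.
  by rewrite !inE eqxx !orbT.
rewrite inE => /orP[/eqP[-> -> _]|/starsP[[v [a|a l r]] pb]].
- exact: child (subs_mem u b).
- by rewrite inE => /eqP[-> -> _]; apply: parent pb.
rewrite !inE => /or3P[]/eqP[-> -> _]; first exact: parent pb.
  by apply: child (subs_left pb).
by apply: child (subs_right pb).
Qed.

Fixpoint map_tree (W : Type) (f : V -> W) b : ltree W :=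
  if b is LNode v l r then LNode (f v) (map_tree f l) (map_tree f r)
  else LLeaf (f (top b)).

End LabelledTrees.

Section MapTree.
Variables (V W : eqType) (f : V -> W).
Implicit Types b : ltree V.

Lemma top_map b : top (map_tree f b) = f (top b).
Proof. by case: b. Qed.

Lemma shape_map b : shape_of (map_tree f b) = shape_of b.
Proof. by elim: b => //= v l -> r ->. Qed.

Lemma verts_map b : verts (map_tree f b) = map f (verts b).
Proof. by elim: b => //= v l -> r ->; rewrite map_cat. Qed.

Lemma leaves_map b : leaves (map_tree f b) = map f (leaves b).
Proof. by elim: b => //= v l -> r ->; rewrite map_cat. Qed.

Lemma stars_map u b : stars (f u) (map_tree f b) =
  [seq (f x.1.1, f x.1.2, f x.2) | x <- stars u b].
Proof.
elim: b u => [v|v l IHl r IHr] u //.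
by rewrite [map_tree _ _]/= !starsN !map_cat IHl IHr /= !top_map.
Qed.

Lemma planted_map u b : planted (f u) (map_tree f b) =
  [seq (f x.1.1, f x.1.2, f x.2) | x <- planted u b].
Proof. by rewrite /planted /= stars_map top_map. Qed.

Lemma map_tree_eq b (b' : ltree W) : shape_of b = shape_of b' ->
  map f (leaves b) = leaves b' -> map f (inners b) = inners b' -> map_tree f b = b'.
Proof.
elim: b b' => [v|v l IHl r IHr] [v'|v' l' r'] //=; first by move=> _ [->].
case=> sl sr; rewrite !map_cat => /eqP + [-> /eqP].
rewrite !eqseq_cat ?size_map ?size_inners ?size_leaves ?sl //.
by move=> /andP[/eqP ll /eqP lr] /andP[/eqP il /eqP ir]; congr LNode; [apply: IHl|apply: IHr].
Qed.

End MapTree.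

Section PlanarTrees.
Variable d : nat.
Local Notation N := d.+3.
Local Notation V := (vertex N).
Local Notation root := (inl ord_max : V).
Implicit Types (t : ptree N) (u v w : V) (b : ltree V).

Fixpoint leaf_inner b : bool :=
  if b is LNode v l r then [&& ~~ is_leaf v, leaf_inner l & leaf_inner r]
  else is_leaf (top b).

Definition sound t (s : seq (V * V * V)) :=
  forall x y z, (x, y, z) \in s -> adj t x y /\ next_nbr t x y = z.

Definition leaf_seq o k : seq V := [seq inl (inord i) | i <- iota o k].

(** [b] is [t] seen from its last leaf. [sound] asks only that the triples of [b] hold in [t]; for a
    planar cubic tree, degrees and connectedness imply that they exhaust it. *)
Definition realizes t b :=
  [/\ leaf_inner b, leaves b = leaf_seq 0 d.+2, uniq (root :: verts b)
    & sound t (planted root b)].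

Lemma leaf_innerP u b p : leaf_inner b -> p \in subs u b -> leaf_inner p.2.
Proof.
elim: b u => [v|v l IHl r IHr] u; first by move=> h; rewrite inE => /eqP->.
move=> /[dup] h /and3P[_ hl hr].
by rewrite /= inE mem_cat => /or3P[/eqP->|/IHl|/IHr] //; apply.
Qed.

Lemma inners_leaf b v : leaf_inner b -> v \in inners b -> ~~ is_leaf v.
Proof.
elim: b => //= w l IHl r IHr /and3P[wl hl hr].
by rewrite inE mem_cat => /or3P[/eqP->|/IHl|/IHr] //; apply.
Qed.

(** * The contour walk and the order of the leaves *)

Section Contour.
Variable t : ptree N.

Definition trace k e := [seq (iter i (contour t) e).2 | i <- iota 0 k].

Lemma traceD k1 k2 e :
  trace (k1 + k2) e = trace k1 e ++ trace k2 (iter k1 (contour t) e).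
Proof.
rewrite /trace iotaD map_cat add0n; congr (_ ++ _).
rewrite -{1}[k1]addn0 iotaDl -map_comp; apply: eq_map => i /=.
by rewrite addnC iterD.
Qed.

(** The walk enters at the top, goes round the left and then the right subtree, and leaves towards
    [u]. *)
Lemma walk_subtree u b : sound t (stars u b) -> leaf_inner b -> exists k,
  iter k (contour t) (u, top b) = (top b, u) /\
  seq.filter is_leaf (trace k (u, top b)) = leaves b.
Proof.
elim: b u => [v|v l IHl r IHr] u st /=.
  move=> vl; exists 1%N; rewrite /= /contour /= vl.
  by have [_ ->] := st v u u (mem_head _ _).
case/and3P => vl hl hr.
have sm x : x \in stars v l \/ x \in stars v r -> x \in stars u (LNode v l r).
  by rewrite starsN !mem_cat => -[]->; rewrite ?orbT.
have [||k1 [it1 tr1]] := IHl v.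
- by move=> x y z h; apply: st; apply: sm; left.
- by [].
have [||k2 [it2 tr2]] := IHr v.
- by move=> x y z h; apply: st; apply: sm; right.
- by [].
have [_ n1] : adj t v u /\ next_nbr t v u = top l.
  by apply: st; rewrite starsN mem_cat !inE eqxx.
have [_ n2] : adj t v (top l) /\ next_nbr t v (top l) = top r.
  by apply: st; rewrite starsN mem_cat !inE eqxx !orbT.
have [_ n3] : adj t v (top r) /\ next_nbr t v (top r) = u.
  by apply: st; rewrite starsN mem_cat !inE eqxx !orbT.
have c1 : contour t (u, v) = (v, top l) by rewrite /contour /= n1.
have c2 : contour t (top l, v) = (v, top r) by rewrite /contour /= n2.
have c3 : contour t (top r, v) = (v, u) by rewrite /contour /= n3.
have t1 e : trace 1 e = [:: e.2] by [].
exists (1 + (k1 + (1 + (k2 + 1))))%N; split.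
  have itD a c e : iter (a + c) (contour t) e = iter c (contour t) (iter a (contour t) e).
    by rewrite addnC iterD.
  by rewrite !itD /= c1 it1 c2 it2 c3.
rewrite !traceD !filter_cat !t1 /= c1 it1 c2 tr1 it2.
by rewrite /= (negPf vl) tr2 cats0.
Qed.

Definition next_leaf (v w : V) := forall u, adj t v u ->
  exists k, (iter k (contour t) (v, u)).2 = w /\
    forall l, (l < k)%N -> ~~ is_leaf (iter l (contour t) (v, u)).2.

Lemma next_leaf_unique v w w' u : adj t v u -> is_leaf w -> is_leaf w' ->
  next_leaf v w -> next_leaf v w' -> w = w'.
Proof.
move=> vu lw lw' /(_ u vu)[k [kw km]] /(_ u vu)[k' [kw' km']].
case: (ltngtP k k') => [kk'|k'k|e]; last by rewrite -kw e kw'.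
  by have := km' _ kk'; rewrite kw lw.
by have := km _ k'k; rewrite kw' lw'.
Qed.

Fixpoint chain (P : V -> V -> Prop) v (s : seq V) : Prop :=
  if s is w :: s' then P v w /\ chain P w s' else True.

(** Only interior vertices occur between successive leaves of the walk; the induction restarts at
    the first leaf met. *)
Lemma trace_chain : symmetric (adj t) ->
  (forall u v, adj t v u -> adj t v (next_nbr t v u)) ->
  (forall i u u', adj t (inl i) u -> adj t (inl i) u' -> u = u') ->
  forall k u v, adj t v u -> is_leaf v ->
  chain next_leaf v (seq.filter is_leaf (trace k (contour t (u, v)))).
Proof.
move=> sym rot deg1; elim/ltn_ind => k IH u v vu lv.
have adjW j : adj t (iter j (contour t) (u, v)).1 (iter j (contour t) (u, v)).2.
  elim: j => [|j IHj] /=; first by rewrite sym.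
  by apply: rot; rewrite sym.
pose P j := is_leaf (iter j (contour t) (contour t (u, v))).2.
have [/hasP[j0]|/hasPn no] := boolP (has P (iota 0 k)); last first.
  rewrite /trace filter_map (_ : seq.filter _ _ = [::]) //.
  by rewrite -(filter_pred0 (iota 0 k)); apply: eq_in_filter => j /no/negPf.
rewrite mem_iota add0n => /andP[_ j0k] Pj0.
have [j Pj jmin] := ex_minnP (ex_intro P j0 Pj0).
have jk : (j < k)%N by apply: leq_ltn_trans (jmin _ Pj0) j0k.
rewrite (_ : k = j + (1 + (k - j.+1)))%N; last by lia.
rewrite !traceD filter_cat (_ : seq.filter is_leaf (trace j _) = [::]); last first.
  rewrite /trace filter_map (_ : seq.filter _ _ = [::]) //.
  rewrite -(filter_pred0 (iota 0 j)); apply: eq_in_filter => i.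
  rewrite mem_iota add0n => /andP[_ ij] /=; apply/negbTE; apply/negP => Pi.
  by have := jmin i Pi; rewrite leqNgt ij.
have itE i : iter i (contour t) (contour t (u, v)) = iter i.+1 (contour t) (u, v).
  by rewrite -iterSr.
set e := iter j _ _; have le : is_leaf e.2 := Pj.
rewrite filter_cat /= le /=.
have -> : (iter 0 (contour t) e).2 = e.2 by [].
split; last first.
  rewrite [e]surjective_pairing; apply: IH => //; first by lia.
  by rewrite sym /e itE; apply: adjW.
move=> x vx; exists j; rewrite /e.
have -> : (v, x) = contour t (u, v).
  rewrite /contour /=; congr (_, _).
  by case: (v) lv vx vu => // i _ ix iu; apply: deg1 ix (rot _ _ iu).
by split=> // l lj; apply/negP => /jmin; rewrite leqNgt lj.
Qed.

Lemma planted_chain b : symmetric (adj t) ->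
  (forall u v, adj t v u -> adj t v (next_nbr t v u)) ->
  (forall i u u', adj t (inl i) u -> adj t (inl i) u' -> u = u') ->
  leaf_inner b -> sound t (planted root b) ->
  chain next_leaf root (rcons (leaves b) root).
Proof.
move=> sym rot deg1 lb st.
have [|k [it tr]] := @walk_subtree root b _ lb.
  by move=> x y z h; apply: st; rewrite inE h orbT.
have [rb nb] := st _ _ _ (mem_head _ _).
have := trace_chain sym rot deg1 (k + 1) rb isT.
rewrite (_ : contour t _ = (root, top b)); last by rewrite /contour /= nb.
by rewrite traceD filter_cat tr it /= cats1.
Qed.

End Contour.

(** Numbers increase by 1 until the root leaf, which has the last number. The reduction modulo [N]
    lets the list start at 0 when [a] is the root leaf itself. *)
Lemma chain_leaf_seq (a : 'I_N) (s : seq V) : root \notin s ->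
  chain (fun x y => forall i, x = inl i -> y = inl (ordS i)) (inl a) (rcons s root) ->
  s = leaf_seq ((a.+1) %% N)%N (d.+2 - (a.+1 %% N))%N.
Proof.
elim: s a => [|y s IH] a /=.
  move=> _ [/(_ a erefl)[e] _]; rewrite -e.
  by rewrite subnn.
rewrite inE negb_or => /andP[yr rs] [/(_ a erefl) ye]; rewrite ye => /(IH _ rs) ->.
have lt : (a.+1 %% N < d.+2)%N.
  have : (a.+1 %% N < N)%N by rewrite ltn_pmod.
  rewrite ltnS leq_eqVlt => /orP[/eqP e|//]; case/negP: yr.
  by rewrite ye; apply/eqP; congr inl; apply: val_inj; rewrite /= e.
rewrite [in LHS]/= [in LHS](modn_small (m := (a.+1 %% N).+1)) ?ltnS //.
rewrite -[in RHS](subnSK lt) /leaf_seq /=; congr (inl _ :: _).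
by apply: val_inj; rewrite /= inordK // ltnS ltnW.
Qed.

Lemma chain_leaf_seqI (P : V -> V -> Prop) : chain P root (rcons (leaf_seq 0 d.+2) root) ->
  forall i : 'I_N, P (inl i) (inl (ordS i)).
Proof.
rewrite /= => -[P0 h].
have gen k o : (o + k = d.+1)%N ->
    chain P (inl (inord o)) (rcons (leaf_seq o.+1 k) root) ->
    forall i : 'I_N, (o <= i)%N -> i != ord_max -> P (inl i) (inl (ordS i)).
  elim: k o => [|k IH] o ok /= [h1 h2] i oi im.
    have -> : i = inord o.
      apply: val_inj; rewrite /= inordK; last by lia.
      by move: im; rewrite -val_eqE /=; have := ltn_ord i; lia.
    rewrite (_ : ordS _ = ord_max) //; apply: val_inj.
    by rewrite /= inordK ?modn_small; lia.
  have [e|ne] := eqVneq (i : nat) o; last by apply: (IH o.+1) => //; lia.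
  have -> : i = inord o by apply: val_inj; rewrite /= inordK; lia.
  rewrite (_ : ordS _ = inord o.+1) //; apply: val_inj.
  by rewrite /= !inordK ?modn_small; lia.
move=> i; have [->|im] := eqVneq i ord_max.
  rewrite (_ : ordS _ = inord 0) //; apply: val_inj.
  by rewrite /= inordK // modnn.
by apply: (gen d.+1 0%N).
Qed.

(** * From a planar cubic tree to a binary tree *)

Section FromTree.
Variable t : ptree N.
Hypothesis pt : planar_cubic t.

Lemma leaf_nbr i u u' : adj t (inl i) u -> adj t (inl i) u' -> u = u'.
Proof.
have /eqP/cards1P[x xP] := pc_leaf_degree pt i.
have nx w : adj t (inl i) w -> w = x.
  move=> h; have : w \in nbrs t (inl i) by rewrite inE.
  by rewrite xP inE => /eqP.
by move=> /nx-> /nx->.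
Qed.

Lemma adj_next u v : adj t v u -> adj t v (next_nbr t v u).
Proof. by move=> vu; have := @pc_rot_nbrs _ _ pt u v; rewrite !inE; apply. Qed.

Lemma inner_nbrs u v : ~~ is_leaf v -> adj t v u ->
  let a := next_nbr t v u in let b := next_nbr t v a in
  [/\ uniq [:: u; a; b], next_nbr t v b = u & forall w, adj t v w = (w \in [:: u; a; b])].
Proof.
move=> lv vu a b; set f := next_nbr t v in a b *.
have card3 : #|nbrs t v| = 3 by case: v lv vu @f @a @b => // i *; apply: pc_interior_degree.
have va := adj_next vu; have vb := adj_next va.
(* A set of at most two vertices that contains a neighbour and is stable under the rotation would
   contain all three neighbours, because the rotation is transitive on them. *)
have small s x : (size s <= 2)%N -> x \in s -> adj t v x -> {in s, forall z, f z \in s} -> False.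
  move=> s2 xs vx fs; suff /subset_leq_card : nbrs t v \subset s.
    by move=> h; have := leq_trans h (leq_trans (card_size s) s2); rewrite card3.
  apply/fintype.subsetP => y vy; have : fconnect f x y.
    by apply: (pc_rot_cyclic pt) => //; rewrite inE.
  move=> /iter_findex <-; elim: findex => //= k; exact: fs.
have au : a != u.
  apply/eqP => e; apply: (@small [:: u] u); rewrite ?inE // => z.
  by rewrite !inE => /eqP->; apply/eqP.
have bu : b != u.
  apply/eqP => e; apply: (@small [:: u; a] u); rewrite ?inE ?eqxx // => z.
  by rewrite !inE => /orP[]/eqP->; rewrite -/a -/b ?e ?eqxx ?orbT.
have ba : b != a.
  apply/eqP => e; apply: (@small [:: a] a); rewrite ?inE ?eqxx // => z.
  by rewrite !inE => /eqP->; rewrite -/b e.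
have uab : uniq [:: u; a; b] by rewrite /= !inE negb_or !(eq_sym u) au bu (eq_sym a) ba.
have nE w : adj t v w = (w \in [:: u; a; b]).
  have c3 : #|[:: u; a; b]| = #|nbrs t v| by rewrite card3; apply/card_uniqP.
  suff sub : [:: u; a; b] \subset nbrs t v.
    by have := subset_cardP c3 sub w; rewrite [w \in nbrs _ _]inE => ->.
  by apply/fintype.subsetP => z; rewrite !inE => /or3P[]/eqP->.
split=> //; have := adj_next vb; rewrite -/f nE !inE => /or3P[]/eqP // e; exfalso.
  apply: (@small [:: a; b] a); rewrite ?inE ?eqxx // => z.
  by rewrite !inE => /orP[]/eqP->; rewrite -/b ?e ?eqxx ?orbT.
apply: (@small [:: b] b); rewrite ?inE ?eqxx // => z.
by rewrite !inE => /eqP->; apply/eqP.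
Qed.

Lemma no_chord u v w (p : seq V) : uniq [:: v, u & p] -> path (adj t) v (u :: p) ->
  adj t v w -> w \notin p.
Proof.
move=> up pp vw; apply/negP => wp; case/splitPr: wp up pp => p1 p2 up pp.
have : ucycle (adj t) [:: v, u & rcons p1 w].
  rewrite /ucycle; apply/andP; split.
    rewrite /= rcons_path last_rcons (pc_sym pt w) vw andbT.
    by move: pp; rewrite /= -cat_rcons cat_path => /andP[-> /andP[]].
  by move: up; rewrite -cat_rcons -!cat_cons cat_uniq => /andP[].
by move/(pc_acyclic pt); rewrite /= size_rcons.
Qed.

(** [u :: p] is the way back to the start and [m] bounds the remaining depth. Acyclicity keeps new
    vertices off this path; that the two subtrees are disjoint is left to a later count. *)
Lemma grow m (p : seq V) u v : (#|V| <= m + size p)%N ->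
  uniq [:: v, u & p] -> path (adj t) v (u :: p) ->
  exists b, [/\ top b = v, leaf_inner b, sound t (stars u b)
    & forall x, x \in verts b -> x \notin u :: p].
Proof.
elim: m p u v => [|m IH] p u v.
  rewrite add0n => szp up _; have := max_card (mem [:: v, u & p]).
  by rewrite (card_uniqP up) /= => h; have := leq_trans h szp; rewrite ltnNge leqnSn.
move=> szp up pp; have vu : adj t v u by case/andP: pp.
have [lv|lv] := boolP (is_leaf v).
  exists (LLeaf v); split=> // [x y z|x].
    rewrite inE => /eqP[-> -> ->]; split=> //.
    case: v lv vu {up pp szp} => // i _ iu; exact: leaf_nbr (adj_next iu) iu.
  by rewrite inE => /eqP->; case/andP: up.
have [] := inner_nbrs lv vu; set a := next_nbr t v u; set b := next_nbr t v a.
move=> uab nb nE.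
have vN w : adj t v w -> w != v.
  by move=> vw; apply/eqP => e; have := pc_irrefl pt v; rewrite -{2}e vw.
have step w : w \in [:: a; b] -> uniq [:: w, v, u & p] && path (adj t) w [:: v, u & p].
  move=> wab; have vw : adj t v w by rewrite nE inE wab orbT.
  have wu : w != u.
    by apply: contraTneq uab => <-; rewrite /= wab.
  apply/andP; split; last by rewrite /= (pc_sym pt w) vw.
  by rewrite cons_uniq up andbT !inE !negb_or (vN _ vw) wu (no_chord up pp vw).
have /andP[ua pa] := step a (mem_head _ _).
have /andP[ub pb] := step b (mem_last a [:: b]).
have [|//|//|l [tl ll sl nl]] := IH (u :: p) v a; first by rewrite /= addnS.
have [|//|//|r [tr lr sr nr]] := IH (u :: p) v b; first by rewrite /= addnS.
exists (LNode v l r); split=> //=; first by rewrite lv ll.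
  move=> x y z; rewrite starsN !mem_cat => /or3P[|/sl//|/sr//].
  rewrite !inE tl tr => /or3P[]/eqP[-> -> ->]; split=> //.
    by rewrite nE !inE eqxx orbT.
  by rewrite nE !inE eqxx !orbT.
move=> x; rewrite inE mem_cat => /or3P[/eqP->|/nl|/nr]; first by case/andP: up.
  by rewrite inE negb_or => /andP[].
by rewrite inE negb_or => /andP[].
Qed.

(** The planted triples already show one neighbour at each leaf and three at each interior vertex,
    which is all that the degrees allow. *)
Lemma planted_complete b x y : leaf_inner b -> sound t (planted root b) ->
  x \in root :: verts b -> adj t x y -> (x, y, next_nbr t x y) \in planted root b.
Proof.
move=> lb st + xy.
have ins z w : (x, z, w) \in planted root b -> z = y -> (x, y, next_nbr t x y) \in planted root b.
  by move=> h e; have [_ nw] := st _ _ _ h; rewrite -e nw.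
rewrite inE => /orP[/eqP xr|].
  have [rb _] := st _ _ _ (mem_head _ _).
  apply: (ins (top b) (top b)); first by rewrite xr mem_head.
  by apply: leaf_nbr rb _; rewrite -xr.
move/(verts_subs root) => [p pb px].
have pst z w : (x, z, w) \in star p -> (x, z, w) \in planted root b.
  by move=> h; rewrite inE; apply/orP; right; apply/starsP; exists p.
case: p pb px pst => u [v|v l r] pb /= vx pst; move: (leaf_innerP lb pb) => /=; subst v.
  move=> lx; have xu := pst u u (mem_head _ _).
  apply: (ins u u) => //; have [xu' _] := st _ _ _ xu.
  by case: (x) lx xu' xy => // i _; apply: leaf_nbr.
case/and3P => lx _ _.
have h1 := pst u (top l); have h2 := pst (top l) (top r); have h3 := pst (top r) u.
rewrite !inE !eqxx !orbT in h1 h2 h3.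
have {}h1 := h1 isT; have {}h2 := h2 isT; have {}h3 := h3 isT.
have [xu n1] := st _ _ _ h1; have [_ n2] := st _ _ _ h2.
have [_ _ /(_ y)] := inner_nbrs lx xu; rewrite n1 n2 xy !inE => /esym/or3P[]/eqP e.
- exact: ins h1 _.
- exact: ins h2 _.
exact: ins h3 _.
Qed.

Lemma planted_mem u b x y z : (x, y, z) \in planted u b -> y \in u :: verts b.
Proof.
rewrite inE => /orP[/eqP[_ -> _]|/starsP[[v [w|w l r]] pb]].
- by rewrite inE top_verts orbT.
- by rewrite inE => /eqP[_ -> _]; apply: (subs_parent_mem pb).
rewrite !inE => /or3P[]/eqP[_ -> _].
- exact: (subs_parent_mem pb).
- by have := subs_top (subs_left pb); rewrite /= => ->; rewrite orbT.
by have := subs_top (subs_right pb); rewrite /= => ->; rewrite orbT.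
Qed.

Lemma planted_cover b v : leaf_inner b -> sound t (planted root b) -> v \in root :: verts b.
Proof.
move=> lb st; have /connectP[p] := pc_connected pt root v.
have gen x : x \in root :: verts b -> path (adj t) x p -> last x p \in root :: verts b.
  elim: p x => //= y p IH x xb /andP[xy py]; apply: IH py.
  exact: planted_mem (planted_complete lb st xb xy).
by move=> pp ->; apply: gen => //; apply: mem_head.
Qed.

Lemma card_vertices : #|V| = (d.+2).*2.
Proof. by rewrite card_sum !card_ord; lia. Qed.

Lemma planar_cubic_realizes : exists b, realizes t b.
Proof.
have [u ru] : exists u, adj t root u.
  have /eqP/cards1P[u uP] := pc_leaf_degree pt ord_max; exists u.
  by have := set11 u; rewrite -uP inE.
have ur : u != root by apply/eqP => e; have := pc_irrefl pt u; rewrite {1}e ru.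
have [|||b [tb lb sb nb]] := @grow #|V| [::] root u.
- by rewrite addn0.
- by rewrite /= inE ur.
- by rewrite /= (pc_sym pt u) ru.
exists b.
have st : sound t (planted root b).
  move=> x y z; rewrite inE => /orP[/eqP[-> -> ->]|/sb//]; rewrite tb; split=> //.
  exact: leaf_nbr (adj_next ru) ru.
have rb : root \notin verts b by apply/negP => /nb; rewrite mem_head.
have ch := planted_chain (pc_sym pt) adj_next leaf_nbr lb st.
have lE : leaves b = leaf_seq 0 d.+2.
  rewrite -[X in leaf_seq X](modnn N) -[X in leaf_seq _ X]subn0 -[X in (_ - X)%N](modnn N).
  apply: (@chain_leaf_seq ord_max).
    by apply: contra rb; rewrite (perm_mem (perm_verts b)) mem_cat => ->.
  have all_leaf : all is_leaf (rcons (leaves b) root).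
    rewrite all_rcons /=; elim: (b) lb => [v|v l IHl r IHr] /=; first by rewrite andbT.
    by case/and3P => _ hl hr; rewrite all_cat IHl ?IHr.
  suff gen s x : all is_leaf s -> chain (next_leaf t) x s ->
      chain (fun x y => forall i, x = inl i -> y = inl (ordS i)) x s by exact: gen.
  elim: s x => // y s IH x /= /andP[ly ls] [xy chs]; split; last exact: IH.
  move=> i xi; have /eqP/cards1P[w wP] := pc_leaf_degree pt i.
  have iw : adj t (inl i) w by have := set11 w; rewrite -wP inE.
  apply: (next_leaf_unique iw) => //; first by rewrite -xi.
  by move=> w' /(pc_boundary pt).
split=> //.
(* The labels cover all vertices and are no more numerous than these, so none is repeated. *)
have : (size (root :: verts b) <= size (enum V))%N.
  rewrite -cardE card_vertices /= size_verts.
  by have := size_leaves b; rewrite lE size_map size_iota => -[<-]; rewrite doubleS.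
apply: leq_size_uniq (enum_uniq _) _ => v _; exact: planted_cover.
Qed.

End FromTree.

(** * Isotopy classes and shapes *)

(** The rotation determines the children: after the parent comes the top of the left subtree, then
    that of the right one. *)
Lemma sound_unique t u b b' : leaf_inner b -> leaf_inner b' ->
  sound t (stars u b) -> sound t (stars u b') -> top b = top b' -> b = b'.
Proof.
elim: b b' u => [v|v l IHl r IHr] [v'|v' l' r'] u /=.
- by move=> _ _ _ _ ->.
- by move=> lv /and3P[lv' _ _] _ _ e; case/negP: lv'; rewrite -e.
- by move=> /and3P[lv _ _] lv' _ _ e; case/negP: lv; rewrite e.
move=> /and3P[_ hl hr] /and3P[_ hl' hr'] st st' e; subst v'.
have sub (x y z : V) (L R : ltree V) : sound t (stars u (LNode v L R)) ->
    (x, y, z) \in star (u, LNode v L R) -> next_nbr t x y = z.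
  move=> s h; have xs : (x, y, z) \in stars u (LNode v L R) by rewrite starsN mem_cat h.
  by have [] := s x y z xs.
have e1 : top l = top l'.
  by rewrite -(sub v u (top l) l r st) ?mem_head // -(sub v u (top l') l' r' st') ?mem_head.
have e2 : top r = top r'.
  rewrite -(sub v (top l) (top r) l r st); last by rewrite !inE eqxx orbT.
  by rewrite -(sub v (top l') (top r') l' r' st') ?e1 // !inE eqxx orbT.
have -> : l = l'.
  apply: (IHl l' v hl hl' _ _ e1) => x y z h; [apply: st|apply: st'];
    by rewrite starsN !mem_cat h orbT.
have -> // : r = r'.
apply: (IHr r' v hr hr' _ _ e2) => x y z h; [apply: st|apply: st'];
  by rewrite starsN !mem_cat h !orbT.
Qed.

Lemma sound_planted_stars t u b : sound t (planted u b) -> sound t (stars u b).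
Proof. by move=> st x y z h; apply: st; rewrite inE h orbT. Qed.

Lemma realizes_unique t b b' : planar_cubic t -> realizes t b -> realizes t b' -> b = b'.
Proof.
move=> pt [lb _ _ st] [lb' _ _ st'].
apply: (sound_unique lb lb' (sound_planted_stars st) (sound_planted_stars st')).
have [r1 _] := st _ _ _ (mem_head _ _); have [r2 _] := st' _ _ _ (mem_head _ _).
exact: leaf_nbr pt _ _ _ r1 r2.
Qed.

Lemma is_leaf_relabel (f : {perm 'I_N.-2}) v : is_leaf (relabel f v) = is_leaf v.
Proof. by case: v. Qed.

Lemma relabel_inj (f : {perm 'I_N.-2}) : injective (relabel f : V -> V).
Proof.
move=> [i|i] [j|j] //= e; congr inr; apply: (@perm_inj _ f).
by case: e.
Qed.

Lemma relabel_leaf_seq (f : {perm 'I_N.-2}) o k : map (relabel f) (leaf_seq o k) = leaf_seq o k.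
Proof. by rewrite -map_comp. Qed.

Lemma isotopicP t t' (f : {perm 'I_N.-2}) : (forall u v,
    (adj t' (relabel f u) (relabel f v) == adj t u v) &&
    (adj t u v ==>
      (next_nbr t' (relabel f u) (relabel f v) == relabel f (next_nbr t u v)))) ->
  isotopic t t'.
Proof. by move=> h; apply/existsP; exists f; apply/forallP => u; apply/forallP. Qed.

Lemma realizes_relabel t t' b : realizes t b -> isotopic t t' ->
  exists f : {perm 'I_N.-2}, realizes t' (map_tree (relabel f) b).
Proof.
move=> [lb le ub st] /existsP[f /forallP fP]; exists f; split.
- elim: b lb {le ub st} => [v|v l IHl r IHr] /=; first by rewrite is_leaf_relabel.
  by rewrite is_leaf_relabel => /and3P[-> /IHl-> /IHr->].
- by rewrite leaves_map le relabel_leaf_seq.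
- by rewrite verts_map -[root]/(relabel f root) -map_cons map_inj_uniq //; apply: relabel_inj.
rewrite -[root]/(relabel f root) planted_map => x y z /mapP[[[x' y'] z'] /st[xy nz] [-> -> ->]] /=.
have /andP[/eqP e /implyP n] := forallP (fP x') y'; split; first by rewrite e.
by rewrite (eqP (n xy)) nz.
Qed.

Lemma relabel_exists b b' : leaf_inner b -> leaf_inner b' ->
  uniq (root :: verts b) -> uniq (root :: verts b') ->
  leaves b = leaf_seq 0 d.+2 -> leaves b' = leaf_seq 0 d.+2 ->
  shape_of b = shape_of b' -> exists f : {perm 'I_N.-2}, map_tree (relabel f) b = b'.
Proof.
move=> lb lb' ub ub' le le' sh.
have sz : ssize (shape_of b) = d.+1 by have := size_leaves b; rewrite le size_map size_iota => -[<-].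
have ui c : uniq (root :: verts c) -> uniq (inners c).
  by rewrite cons_uniq (perm_uniq (perm_verts c)) cat_uniq => /and4P[].
have nodes c : leaf_inner c -> uniq (root :: verts c) -> ssize (shape_of c) = d.+1 ->
    forall j : 'I_N.-2, inr j \in inners c.
  move=> lc uc sc j.
  have sub : {subset inners c <= [seq inr i | i <- enum 'I_N.-2]}.
    move=> [i|i] h; first by have := inners_leaf lc h.
    by apply: map_f; rewrite mem_enum.
  have [|_ ->] := uniq_min_size (ui c uc) sub.
    by rewrite size_map -cardE card_ord size_inners sc.
  by apply: map_f; rewrite mem_enum.
(* Interior labels at equal positions correspond; the default [j] is never reached, since these
   positions hold interior vertices. *)
pose g (j : 'I_N.-2) : 'I_N.-2 :=
  if nth root (inners b') (index (inr j) (inners b)) is inr k then k else j.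
have szi : size (inners b) = size (inners b') by rewrite !size_inners sh.
have gE j : inr (g j) = nth root (inners b') (index (inr j) (inners b)).
  have : nth root (inners b') (index (inr j) (inners b)) \in inners b'.
    by rewrite mem_nth // -szi index_mem nodes.
  by rewrite /g; case: nth => // i /(inners_leaf lb').
have gI : injective g.
  move=> i j /(congr1 (inr : _ -> V)); rewrite !gE => /eqP.
  rewrite nth_uniq ?ui // -?szi ?index_mem ?nodes // => /eqP e.
  have := nth_index root (nodes b lb ub sz i); rewrite e nth_index ?nodes //.
  by case.
exists (perm gI); apply: map_tree_eq => //.
  by rewrite le relabel_leaf_seq.
apply: (@eq_from_nth _ root); rewrite size_map // => k kb.
rewrite (nth_map root) //.
have := mem_nth root kb; case e : (nth root (inners b) k) => [i|j].
  by move/(inners_leaf lb).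
by move=> _; rewrite /= permE gE -e index_uniq ?ui.
Qed.

Lemma isotopic_shape t t' b b' : planar_cubic t -> planar_cubic t' ->
  realizes t b -> realizes t' b' -> isotopic t t' <-> shape_of b = shape_of b'.
Proof.
move=> pt pt' rb rb'; split=> [iso|sh].
  have [f rf] := realizes_relabel rb iso.
  by rewrite -(realizes_unique pt' rf rb') shape_map.
have [lb le ub st] := rb; have [lb' le' ub' st'] := rb'.
have [f fb] := relabel_exists lb lb' ub ub' le le' sh.
have pE : planted root b' = [seq (relabel f x.1.1, relabel f x.1.2, relabel f x.2) | x <- planted root b].
  by rewrite -fb -planted_map.
apply: (isotopicP (f := f)) => u v; apply/andP; split; last first.
  apply/implyP => uv.
  have h := planted_complete pt lb st (planted_cover pt u lb st) uv.
  have : (relabel f u, relabel f v, relabel f (next_nbr t u v)) \in planted root b'.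
    by rewrite pE; apply: (map_f (fun x => (relabel f x.1.1, relabel f x.1.2, relabel f x.2)) h).
  by move/st' => [_ ->].
apply/eqP; apply/idP/idP => uv.
  have := planted_complete pt' lb' st' (planted_cover pt' _ lb' st') uv.
  rewrite pE => /mapP[[[x y] z] h [/relabel_inj eu /relabel_inj ev _]].
  by rewrite eu ev; case: (st _ _ _ h).
have h := planted_complete pt lb st (planted_cover pt u lb st) uv.
have : (relabel f u, relabel f v, relabel f (next_nbr t u v)) \in planted root b'.
  by rewrite pE; apply: (map_f (fun x => (relabel f x.1.1, relabel f x.1.2, relabel f x.2)) h).
by move/st' => [].
Qed.

(** * From a binary tree to a planar cubic tree *)

(** One offset serves both numberings: a left subtree together with its parent has as many nodes as
    the left subtree has leaves. *)
Fixpoint label o s : ltree V :=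
  if s is Bin l r then
    LNode (inr (inord (o + ssize l))) (label o l) (label (o + ssize l).+1 r)
  else LLeaf (inl (inord o)).

Lemma shape_label o s : shape_of (label o s) = s.
Proof. by elim: s o => //= l IHl r IHr o; rewrite IHl IHr. Qed.

Lemma leaves_label o s : leaves (label o s) = leaf_seq o (ssize s).+1.
Proof.
elim: s o => //= l IHl r IHr o.
rewrite IHl IHr /leaf_seq -map_cat (_ : (_ + _).+2 = (ssize l).+1 + (ssize r).+1)%N; last by lia.
by rewrite iotaD addnS.
Qed.

Lemma leaf_inner_label o s : leaf_inner (label o s).
Proof. by elim: s o => //= l IHl r IHr o; rewrite IHl IHr. Qed.

Lemma inners_label o s c : node s o c -> inr (inord c) \in inners (label o s).
Proof.
elim: s o => [|l IHl r IHr] o; first by rewrite /node /=; lia.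
rewrite inE mem_cat => /nodeP[[/IHl-> _]|->|[/IHr-> _]]; rewrite ?orbT //.
by rewrite eqxx.
Qed.

Lemma label_cover s v : ssize s = d.+1 -> v \in root :: verts (label 0 s).
Proof.
move=> sz; rewrite inE (perm_mem (perm_verts _)) mem_cat leaves_label sz.
case: v => [i|i].
  have [->|ir] := eqVneq i ord_max; first by rewrite eqxx.
  apply/orP; right; apply/orP; left; apply/mapP; exists (i : nat); last by rewrite inord_val.
  by rewrite mem_iota; move: ir; rewrite -val_eqE /=; have := ltn_ord i; lia.
have : node s 0 i by rewrite /node sz /= (ltn_ord i).
by move/inners_label; rewrite inord_val => ->; rewrite !orbT.
Qed.

Lemma uniq_label s : ssize s = d.+1 -> uniq (root :: verts (label 0 s)).
Proof.
move=> sz; apply: (@leq_size_uniq _ (enum V)); rewrite ?enum_uniq //.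
  by move=> v _; apply: label_cover.
by rewrite -cardE card_vertices /= size_verts shape_label sz doubleS.
Qed.

Lemma star_nodeP b u v l r : uniq (root :: verts b) -> (u, LNode v l r) \in subs root b ->
  uniq [:: u; top l; top r] /\ v \notin [:: u; top l; top r].
Proof.
move=> ub /(subs_uniq ub) /=; rewrite !inE !mem_cat !negb_or cat_uniq.
case/and3P => /and3P[uv ul ur] /andP[vl vr] /and3P[_ /hasPn lr _].
have ne (x y : V) (s : seq V) : x \notin s -> y \in s -> x != y by move=> xs ys; apply: contraNneq xs => ->.
rewrite (ne _ _ _ ul (top_verts l)) (ne _ _ _ ur (top_verts r)).
rewrite (eq_sym (top l)) (ne _ _ _ (lr _ (top_verts r)) (top_verts l)) (eq_sym v) uv.
by rewrite (ne _ _ _ vl (top_verts l)) (ne _ _ _ vr (top_verts r)).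
Qed.

Section TreeOf.
Variable b : ltree V.
Hypothesis lb : leaf_inner b.
Hypothesis ub : uniq (root :: verts b).
Hypothesis cb : forall v, v \in root :: verts b.
Hypothesis leb : leaves b = leaf_seq 0 d.+2.

(** Edges and rotation are read off the planted triples; [root] is a default at pairs that are not
    edges. *)
Definition tree_of : ptree N :=
  ([set e | e \in [seq x.1 | x <- planted root b]]%SET,
   [ffun e => odflt root (ohead [seq x.2 | x <- planted root b & x.1 == e])]).

Let t := tree_of.

Let adjP x y : reflect (exists z, (x, y, z) \in planted root b) (adj t x y).
Proof.
rewrite /adj inE; apply: (iffP mapP) => [[[e z] h /= ->]|[z h]]; first by exists z.
by exists (x, y, z).
Qed.

Let star_sub p : p \in subs root b -> {subset star p <= planted root b}.
Proof. by move=> pb x xp; rewrite inE; apply/orP; right; apply/starsP; exists p. Qed.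

Let inner_star x y z : ~~ is_leaf x -> (x, y, z) \in planted root b ->
  exists u l r, (u, LNode x l r) \in subs root b /\
    (x, y, z) \in star (u, LNode x l r).
Proof.
move=> lx; rewrite inE => /orP[/eqP[xr _ _]|/starsP[p pb ps]]; first by rewrite xr in lx.
case: p pb ps => u [v|v l r] pb ps; have /= xv := star_top ps; subst v.
  by have := leaf_innerP lb pb; rewrite /= (negPf lx).
by exists u, l, r.
Qed.

Let leaf_star x y z y' z' : is_leaf x -> (x, y, z) \in planted root b ->
  (x, y', z') \in planted root b -> y = y' /\ z = z' /\ z = y.
Proof.
move=> lx; have [->|xr] := eqVneq x root.
  by rewrite !planted_root // => /eqP[-> ->] /eqP[-> ->].
rewrite inE => /orP[/eqP[e]|/starsP[p pb ps]]; first by rewrite e eqxx in xr.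
have /= xp := star_top ps; rewrite (mem_planted ub pb) //.
case: p pb ps xp => u [v|v l r] pb.
  by rewrite !inE => /eqP[_ -> ->] _ /eqP[_ -> ->].
by move=> _ /= xv; have /= := leaf_innerP lb pb; rewrite -xv lx.
Qed.

Let functional x y z z' : (x, y, z) \in planted root b ->
  (x, y, z') \in planted root b -> z = z'.
Proof.
have [lx|lx] := boolP (is_leaf x).
  by move=> h h'; have [_ []] := leaf_star lx h h'.
move=> /(inner_star lx)[u [l [r [pb ps]]]]; rewrite (mem_planted ub pb) // => ps'.
have [] := star_nodeP ub pb; rewrite /= !inE !negb_or.
case/and3P => /andP[ul ur] lr _ _; move: ps ps'; rewrite !inE !xpair_eqE !eqxx /=.
by case/or3P => /andP[/eqP-> /eqP->]; rewrite ?eqxx ?(negPf ul) ?(negPf ur) ?(negPf lr)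
  ?[top l == u]eq_sym ?[top r == u]eq_sym ?[top r == top l]eq_sym
  ?(negPf ul) ?(negPf ur) ?(negPf lr) /= ?orbF => /eqP->.
Qed.

Lemma tree_of_sound : sound t (planted root b).
Proof.
move=> x y z h; split; first by apply/adjP; exists z.
rewrite /next_nbr /t /= ffunE.
case e : [seq x0.2 | x0 <- planted root b & x0.1 == (x, y)] => [|w s] /=.
  have : z \in [seq x0.2 | x0 <- planted root b & x0.1 == (x, y)].
    by apply/mapP; exists (x, y, z) => //; rewrite mem_filter /= eqxx.
  by rewrite e.
have : w \in [seq x0.2 | x0 <- planted root b & x0.1 == (x, y)] by rewrite e mem_head.
case/mapP => -[xy z']; rewrite mem_filter /= => /andP[/eqP-> h'] ->.
exact: functional h' h.
Qed.

Let next x y z : (x, y, z) \in planted root b -> next_nbr t x y = z.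
Proof. by move/tree_of_sound => []. Qed.

Let sym : symmetric (adj t).
Proof.
suff h x y : adj t x y -> adj t y x by move=> x y; apply/idP/idP; apply: h.
by move/adjP => [z /planted_sym[w h]]; apply/adjP; exists w.
Qed.

Let leaf_adj x : is_leaf x -> exists y, forall z, adj t x z = (z == y).
Proof.
move=> lx; have [y yP] : exists y, adj t x y.
  have := cb x; rewrite inE => /orP[/eqP->|/(verts_subs root)[p pb <-]].
    by exists (top b); apply/adjP; exists (top b); rewrite mem_head.
  by have [w h] := star_first p; exists p.1; apply/adjP; exists w; apply: star_sub h.
exists y => z; apply/idP/eqP => [|->//]; move/adjP: yP => [w h] /adjP[w' h'].
by have [] := leaf_star lx h' h.
Qed.

Let inner_adj x : ~~ is_leaf x -> exists u l r, (u, LNode x l r) \in subs root b /\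
  (forall z, adj t x z = (z \in [:: u; top l; top r])).
Proof.
move=> lx; have := cb x; rewrite inE => /orP[/eqP xr|/(verts_subs root)[p pb px]].
  by rewrite xr in lx.
case: p pb px => u [v|v l r] pb /= px; subst v.
  by have := leaf_innerP lb pb; rewrite /= (negPf lx).
exists u, l, r; split=> // z; apply/adjP/idP => [[w]|].
  rewrite (mem_planted ub pb) // !inE => /or3P[]/eqP[-> _]; rewrite ?eqxx ?orbT //.
have sp := star_sub pb; rewrite !inE => /or3P[]/eqP->;
  [exists (top l)|exists (top r)|exists u]; apply: sp; rewrite !inE eqxx ?orbT //.
Qed.

Let rot_node x u l r : (u, LNode x l r) \in subs root b ->
  [/\ next_nbr t x u = top l, next_nbr t x (top l) = top r & next_nbr t x (top r) = u].
Proof.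
by move=> pb; split; apply: next; apply: (star_sub pb); rewrite !inE eqxx ?orbT.
Qed.

Let adj_rot u v : adj t v u -> adj t v (next_nbr t v u).
Proof.
have [lv|lv] := boolP (is_leaf v).
  move=> /[dup] vu /adjP[w h]; have [_ [_ e]] := leaf_star lv h h.
  by rewrite (next h) e.
have [p [l [r [pb ax]]]] := inner_adj lv; have [n1 n2 n3] := rot_node pb.
by rewrite !ax !inE => /or3P[]/eqP->; rewrite ?n1 ?n2 ?n3 eqxx ?orbT.
Qed.

Let parent_or_child v y : adj t v y -> v != root ->
  exists2 p, p \in subs root b & top p.2 = v /\
    (y = p.1 \/ exists2 q, q \in subs root b & top q.2 = y /\
       (size (verts q.2) < size (verts p.2))%N).
Proof.
move/adjP => [z]; rewrite inE => /orP[/eqP[-> _ _]|/starsP[p pb ps] _]; first by rewrite eqxx.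
have /= vp := star_top ps; exists p => //; split=> //.
case: p pb ps vp => u [w|w l r] pb; rewrite !inE; first by move=> /eqP[_ -> _]; left.
case/or3P => /eqP[_ -> _] _; first by left.
  right; exists (w, l); first exact: subs_left pb.
  by split=> //=; rewrite size_cat; lia.
right; exists (w, r); first exact: subs_right pb.
by split=> //=; rewrite size_cat; lia.
Qed.

(** At a vertex of the cycle with the smallest subtree, no neighbour on the cycle is a child, so its
    two distinct neighbours there would both be its parent. *)
Let acyclic c : ucycle (adj t) c -> (size c <= 2)%N.
Proof.
case/andP => cc uc; rewrite leqNgt; apply/negP => c3.
pose P k := has (fun p => (top p.2 \in c) && (size (verts p.2) == k)) (subs root b).
have [k /hasP[p pb /andP[pc /eqP pk]] kmin] : exists2 k, P k & forall j, P j -> (k <= j)%N.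
  have [v vc vr] : exists2 v, v \in c & v != root.
    case: c uc c3 {cc P} => [|x [|y c]] //= /andP[]; rewrite inE negb_or => /andP[xy _] _ _.
    have [e|] := eqVneq x root; last by exists x; rewrite ?mem_head.
    by exists y; rewrite ?inE ?eqxx ?orbT // -e eq_sym.
  have := cb v; rewrite inE (negPf vr) => /(verts_subs root)[p pb pv].
  have Pp : P (size (verts p.2)) by apply/hasP; exists p => //; rewrite pv vc eqxx.
  by have [k Pk kmin] := ex_minnP (ex_intro P _ Pp); exists k.
set v := top p.2 in pc.
have vr : v != root.
  by apply: contraTneq ub => vr; rewrite /= -vr (subs_top pb).
have par y : y \in c -> adj t v y -> y = p.1.
  move=> yc /parent_or_child/(_ vr)[q qb [qv]].
  have -> : q = p by apply: subs_inj qb pb qv; case/andP: ub.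
  case=> // -[q' qb' [q'y]]; rewrite pk ltnNge kmin //.
  by apply/hasP; exists q' => //; rewrite q'y yc eqxx.
have [i c' cE] := rot_to pc.
have sc' : (2 < size (v :: c'))%N by rewrite -cE size_rot.
have : path.cycle (adj t) (v :: c') by rewrite -cE rot_cycle.
have : uniq (v :: c') by rewrite -cE rot_uniq.
have mc' y : y \in c' -> y \in c by move=> yc'; rewrite -(mem_rot i) cE inE yc' orbT.
case: c' {cE} sc' mc' => [|y c'] //; case/lastP: c' => // c' z _ mc'.
rewrite /= rcons_path last_rcons mem_rcons inE negb_or => /and3P[_ /andP[yz _] _].
case/and3P => vy _ zv; case/negP: yz.
by rewrite (par y _ vy) ?mc' ?mem_head // (par z) ?mc' ?inE ?mem_rcons ?mem_head ?orbT // sym.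
Qed.

Lemma tree_of_planar_cubic : planar_cubic t.
Proof.
split=> //.
- move=> v; apply/negbTE/negP => /adjP[z]; rewrite inE => /orP[/eqP[-> e _]|/starsP[p pb]].
    by case/andP: ub => /negP[]; rewrite e top_verts.
  case: p pb => u [w|w l r] pb; rewrite !inE.
    move=> /eqP[-> e _]; have /= := subs_uniq ub pb.
    by rewrite e inE eqxx.
  have [_] := star_nodeP ub pb; rewrite !inE !negb_or => /and3P[h1 h2 h3].
  by case/or3P => /eqP[-> e _]; [case/eqP: h1|case/eqP: h2|case/eqP: h3].
- suff con v : connect (adj t) root v.
    move=> u v; apply: connect_trans (con v).
    by rewrite (sym_connect_sym sym).
  have gen u b' : connect (adj t) root u ->
      (forall p, p \in subs u b' -> adj t p.1 (top p.2)) ->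
      forall p, p \in subs u b' -> connect (adj t) root (top p.2).
    elim: b' u => [w|w l IHl r IHr] u cu ad p.
      rewrite inE => /eqP->; apply: connect_trans cu (connect1 _).
      exact: (ad (u, LLeaf w) (mem_head _ _)).
    have cw : connect (adj t) root w.
      apply: connect_trans cu (connect1 _).
      exact: (ad (u, LNode w l r) (mem_head _ _)).
    rewrite /= inE mem_cat => /or3P[/eqP->//|pl|pr].
      by apply: (IHl w) pl => // q ql; apply: ad; rewrite /= inE mem_cat ql orbT.
    by apply: (IHr w) pr => // q qr; apply: ad; rewrite /= inE mem_cat qr !orbT.
  have := cb v; rewrite inE => /orP[/eqP->|/(verts_subs root)[p pb <-]].
    exact: connect0.
  apply: (gen root b) pb => [|q qb]; first exact: connect0.
  have [w h] := star_first q; rewrite sym; apply/adjP; exists w.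
  exact: star_sub qb _ h.
- move=> i; have [y yP] := @leaf_adj (inl i) isT.
  by rewrite (_ : nbrs t _ = [set y]%SET) ?cards1 //; apply/finset.setP => z; rewrite !inE yP.
- move=> i; have [u [l [r [pb ax]]]] := @inner_adj (inr i) isT.
  have [/card_uniqP/= <- _] := star_nodeP ub pb.
  by apply: eq_card => z; rewrite !inE ax !inE.
- by move=> u v; rewrite !inE; apply: adj_rot.
- move=> u w v; rewrite !inE; have [lv|lv] := boolP (is_leaf v).
    by have [y yP] := leaf_adj lv; rewrite !yP => /eqP-> /eqP->.
  have [p [l [r [pb ax]]]] := inner_adj lv; have [n1 n2 n3] := rot_node pb.
  have f1 : fconnect (next_nbr t v) p (top l) by rewrite -n1 fconnect1.
  have f2 : fconnect (next_nbr t v) (top l) (top r) by rewrite -n2 fconnect1.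
  have f3 : fconnect (next_nbr t v) (top r) p by rewrite -n3 fconnect1.
  rewrite !ax !inE => /or3P[]/eqP-> /or3P[]/eqP->; rewrite ?connect0 //.
  + exact: connect_trans f1 f2.
  + exact: connect_trans f2 f3.
  exact: connect_trans f3 f1.
have deg1 i u u' : adj t (inl i) u -> adj t (inl i) u' -> u = u'.
  by have [y yP] := @leaf_adj (inl i) isT; rewrite !yP => /eqP-> /eqP->.
have := planted_chain sym adj_rot deg1 lb tree_of_sound.
rewrite leb => /chain_leaf_seqI h i u iu.
by have [k [kE kmin]] := h i u iu; exists k.
Qed.

End TreeOf.

Lemma realizes_tree_of sh : ssize sh = d.+1 ->
  planar_cubic (tree_of (label 0 sh)) /\ realizes (tree_of (label 0 sh)) (label 0 sh).
Proof.
move=> sz; have ll : leaves (label 0 sh) = leaf_seq 0 d.+2 by rewrite leaves_label sz.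
have cov v := label_cover v sz; have ub := uniq_label sz.
split; first exact: tree_of_planar_cubic (leaf_inner_label 0 sh) ub cov ll.
split=> //; first exact: leaf_inner_label.
exact: tree_of_sound (leaf_inner_label 0 sh) ub.
Qed.

Definition is_node b : bool := if b is LNode _ _ _ then true else false.

Lemma subs_parent_inner u b p : ~~ is_leaf u -> leaf_inner b -> p \in subs u b -> ~~ is_leaf p.1.
Proof.
move=> lu lb /subs_parent[->//|[w [l [r [h _]]]]].
by have /= /andP[] := leaf_innerP lb h.
Qed.

(** * Interior edges and the leaves on either side *)

Section Edges.
Variables (t : ptree N) (b : ltree V).
Hypotheses (pt : planar_cubic t) (rb : realizes t b).

Let lb : leaf_inner b. Proof. by case: rb. Qed.
Let ub : uniq (root :: verts b). Proof. by case: rb. Qed.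
Let st : sound t (planted root b). Proof. by case: rb. Qed.

Let adj_star x y : adj t x y ->
  x = root \/ exists2 p, p \in subs root b & top p.2 = x /\
    (y = p.1 \/ exists2 q, q \in subs p.1 p.2 & q.1 = x /\ top q.2 = y).
Proof.
move=> xy; have := planted_complete pt lb st (planted_cover pt x lb st) xy.
rewrite inE => /orP[/eqP[-> _ _]|/starsP[p pb ps]]; [by left|right].
have /= xp := star_top ps; exists p => //; split=> //.
case: p pb ps xp => u [w|w l r] pb; rewrite !inE; first by move=> /eqP[_ -> _]; left.
case/or3P => /eqP[_ -> _] /= xw; first by left.
  by right; exists (w, l); rewrite ?inE ?mem_cat ?subs_mem ?orbT.
by right; exists (w, r); rewrite ?inE ?mem_cat ?subs_mem ?orbT.
Qed.

Lemma adj_parent p : p \in subs root b -> adj t p.1 (top p.2).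
Proof.
move=> pb; have [w h] := star_first p; rewrite (pc_sym pt).
have : (top p.2, p.1, w) \in planted root b.
  by rewrite inE; apply/orP; right; apply/starsP; exists p.
by move/st => [].
Qed.

Definition edge_of (p : V * ltree V) : {set V} := [set p.1; top p.2]%SET.

Lemma parent_notin p : p \in subs root b -> p.1 \notin verts p.2.
Proof. by move=> pb; case/andP: (subs_uniq ub pb). Qed.

(** A neighbour is a child or the parent, and the parent lies outside the subtree only at the top,
    where the edge is the excluded one. *)
Lemma subtree_closed p x y : p \in subs root b -> adj t x y -> [set x; y]%SET != edge_of p ->
  x \in verts p.2 -> y \in verts p.2.
Proof.
move=> pb xy ne xp.
have xr : x != root.
  by apply: contraTneq ub => xr; rewrite /= -xr (subs_verts_sub pb).
case: (adj_star xy) => [e|]; first by rewrite e eqxx in xr.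
case=> q qb [qx] yq; have [q' qp q'x] := verts_subs p.1 xp.
have qq' : q = q'.
  apply: subs_inj qb (subs_trans pb qp) _; last by rewrite q'x.
  by case/andP: ub.
subst q'; case: yq => [yq|[q'' q''q [_ <-]]]; last exact: (subs_top (subs_trans qp q''q)).
have := subs_parent_mem qp; rewrite -yq inE => /orP[/eqP yp|//].
have [e|[w [l [r [h _]]]]] := subs_parent qp; last first.
  by have := subs_top h; rewrite /= -yq.
case/eqP: ne; rewrite /edge_of finset.setUC yp; congr (_ :|: [set _])%SET.
by rewrite -qx e.
Qed.

Let off_edge p : rel V := fun u v => adj t u v && ([set u; v]%SET != edge_of p).

Let off_sym p : symmetric (off_edge p).
Proof. by move=> x y; rewrite /off_edge (pc_sym pt x) finset.setUC. Qed.

Let connect_closed p x y : p \in subs root b -> connect (off_edge p) x y ->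
  (x \in verts p.2) = (y \in verts p.2).
Proof.
move=> pb; have step u v : off_edge p u v -> u \in verts p.2 -> v \in verts p.2.
  by case/andP => uv ne; apply: subtree_closed pb uv ne.
case/connectP => s; elim: s x => [|z s IH] x /=; first by move=> _ ->.
case/andP => xz zs /(IH _ zs) <-; apply/idP/idP; first exact: step.
by apply: step; rewrite off_sym.
Qed.

Let connect_end p y : p \in subs root b ->
  connect (off_edge p) p.1 y || connect (off_edge p) (top p.2) y.
Proof.
move=> pb; have /connectP[s] := pc_connected pt p.1 y.
pose near x := connect (off_edge p) p.1 x || connect (off_edge p) (top p.2) x.
rewrite -/(near y); suff gen x : near x -> path (adj t) x s -> near (last x s).
  by move=> ps ->; apply: gen; rewrite // /near connect0.
elim: s x => //= z s IH x xc /andP[xz zs]; apply: IH zs.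
have [e|ne] := eqVneq [set x; z]%SET (edge_of p).
  have : z \in edge_of p by rewrite -e !inE eqxx orbT.
  by rewrite /near !inE => /orP[]/eqP->; rewrite connect0 ?orbT.
have xz' : connect (off_edge p) x z by apply: connect1; rewrite /off_edge xz ne.
by case/orP: xc => h; rewrite /near (connect_trans h xz') ?orbT.
Qed.

Lemma edge_side_top p : p \in subs root b ->
  edge_side t (edge_of p) (top p.2) = [set i | inl i \in verts p.2]%SET.
Proof.
move=> pb; apply/finset.setP => i; rewrite !inE; apply/idP/idP => [h|ip].
  by rewrite -(connect_closed pb h) top_verts.
case/orP: (connect_end (inl i) pb) => // h.
by have := connect_closed pb h; rewrite ip (negPf (parent_notin pb)).
Qed.

Lemma edge_side_parent p : p \in subs root b ->
  edge_side t (edge_of p) p.1 = (~: [set i | inl i \in verts p.2])%SET.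
Proof.
move=> pb; apply/finset.setP => i; rewrite !inE; apply/idP/idP => [h|ip].
  by rewrite -(connect_closed pb h) parent_notin.
case/orP: (connect_end (inl i) pb) => // h.
by have := connect_closed pb h; rewrite (negPf ip) top_verts.
Qed.

Lemma interior_edgesP e : reflect
  (exists2 p, [&& p \in subs root b, is_node p.2 & ~~ is_leaf p.1] & e = edge_of p)
  (e \in interior_edges t).
Proof.
have node_top p : p \in subs root b -> is_node p.2 = ~~ is_leaf (top p.2).
  by move/(leaf_innerP lb); case: p.2 => [v|v l r] /=; [move->|case/andP].
rewrite inE; apply: (iffP existsP) => [[i /existsP[j /andP[ij /eqP->]]]|[p /and3P[pb np lp] ->]].
  case: (adj_star ij) => // -[p pb [pi]] [pj|[q qp [qi qj]]].
    exists p; first by rewrite pb node_top // pi -pj.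
    by rewrite /edge_of pi -pj finset.setUC.
  have qb := subs_trans pb qp.
  exists q; first by rewrite qb node_top // qi qj.
  by rewrite /edge_of qi qj.
have := adj_parent pb; rewrite node_top // in np; move: lp np; rewrite /edge_of.
case: p.1 => // i _; case: (top p.2) => // j _ ij.
by exists i; apply/existsP; exists j; rewrite ij eqxx.
Qed.

(** Edges with different lower ends could agree only if each of these ends were the parent of the
    other, against the strict decrease of subtree sizes. *)
Lemma edge_of_inj p q : p \in subs root b -> q \in subs root b -> edge_of p = edge_of q -> p = q.
Proof.
move=> pb qb e; have uvb : uniq (verts b) by case/andP: ub.
have [//|pq] := eqVneq (top p.2) (top q.2); first exact: subs_inj uvb pb qb.
have : top p.2 \in edge_of q by rewrite -e !inE eqxx orbT.
have : top q.2 \in edge_of p by rewrite e !inE eqxx orbT.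
rewrite /edge_of !inE (negPf pq) [top q.2 == top p.2]eq_sym (negPf pq) !orbF.
move=> /eqP qp /eqP pq'.
have strict r r' : r \in subs root b -> r' \in subs root b -> top r.2 = r'.1 ->
    (size (verts r'.2) < size (verts r.2))%N.
  move=> rb' rb'' e'; case: (subs_parent rb'') => [re|[w [l [r0 [h c]]]]].
    by case/andP: ub => /negP[]; have := subs_top rb'; rewrite e' re.
  have -> : r = (w, LNode r'.1 l r0) by apply: (subs_inj uvb rb' h).
  by rewrite /= size_cat; case: c => ->; lia.
have := strict _ _ qb pb qp; have := strict _ _ pb qb pq'.
by lia.
Qed.

Lemma prod_interior_edges (R : comPzRingType) (G : {set V} -> R) :
  \prod_(e in interior_edges t) G e =
  \prod_(p <- subs root b | is_node p.2 && ~~ is_leaf p.1) G (edge_of p).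
Proof.
rewrite -big_enum -[RHS]big_filter -[RHS](big_map edge_of predT).
apply/perm_big/uniq_perm; first exact: enum_uniq.
  rewrite map_inj_in_uniq; last first.
    by move=> p q; rewrite !mem_filter => /andP[_ pb] /andP[_ qb]; apply: edge_of_inj.
  rewrite filter_uniq //; apply: (@map_uniq _ _ (fun p => top p.2)).
  by rewrite subs_verts; case/andP: ub.
move=> e; rewrite mem_enum; apply/interior_edgesP/mapP => -[p].
  by case/and3P=> pb np lp ->; exists p; rewrite // mem_filter np lp.
by rewrite mem_filter => /andP[/andP[np lp] pb] ->; exists p; rewrite // pb np.
Qed.

End Edges.

(** * The amplitude as a sum over shapes *)

Section Mandelstam.
Variables (R : realType) (s : 'M[R]_N).
Hypothesis ms : mandelstam s.

Definition pair_sum (S : {set 'I_N}) : R :=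
  \sum_(i in S) \sum_(j in S | (i < j)%N) s i j.

Lemma pair_sum_double (S : {set 'I_N}) :
  pair_sum S + pair_sum S = \sum_(i in S) \sum_(j in S) s i j.
Proof.
have [s0 sC _] := ms.
have -> : pair_sum S + pair_sum S =
    pair_sum S + \sum_(i in S) \sum_(j in S | (j < i)%N) s i j.
  congr (_ + _); rewrite /pair_sum (exchange_big_dep (mem S)) /=; last by move=> i j _ /andP[].
  apply: eq_bigr => i iS; apply: eq_big => [j|j _]; last by rewrite sC.
  by rewrite iS.
rewrite /pair_sum -big_split /=; apply: eq_bigr => i iS.
rewrite [RHS](bigID (fun j : 'I_N => (i < j)%N)) /=; congr (_ + _).
rewrite [RHS](bigD1 i) ?ltnn ?iS //= s0 add0r; apply: eq_bigl => j.
by rewrite -leqNgt ltn_neqAle -andbA [in RHS]andbA [in RHS]andbAC -andbA.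
Qed.

(** Since row sums vanish, twice either side is minus the sum of s_ij over i in S and j outside S,
    which is symmetric in S and its complement. *)
Lemma pair_sum_setC (S : {set 'I_N}) : pair_sum (~: S) = pair_sum S.
Proof.
have [s0 sC s1] := ms.
have half (x y : R) : x + x = y + y -> x = y.
  by move=> h; lra.
apply: half; rewrite !pair_sum_double.
have row (T : {set 'I_N}) i : \sum_(j in T) s i j = - \sum_(j in ~: T) s i j.
  apply/eqP; rewrite -addr_eq0; apply/eqP; rewrite -[RHS](s1 i) [RHS](bigID (mem T)) /=.
  by congr (_ + _); apply: eq_bigl => j; rewrite inE.
rewrite (eq_bigr _ (fun i _ => row (~: S)%SET i)) [RHS](eq_bigr _ (fun i _ => row S i)).
rewrite finset.setCK !sumrN; congr (- _); rewrite exchange_big /=.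
by apply: eq_bigr => i _; apply: eq_bigr => j _; rewrite sC.
Qed.

(** Both ends are included because a subtree with k nodes has k + 1 leaves. *)
Definition interval_sum (o k : nat) : R :=
  \sum_(i < N | (o <= i <= o + k)%N) \sum_(j < N | (o <= j <= o + k)%N && (i < j)%N) s i j.

Lemma pair_sum_leaves b o : leaf_inner b ->
  leaves b = leaf_seq o (ssize (shape_of b)).+1 -> (o + ssize (shape_of b) < N)%N ->
  pair_sum [set i | inl i \in verts b]%SET = interval_sum o (ssize (shape_of b)).
Proof.
move=> lb leb lt.
have mem i : (i \in [set i | inl i \in verts b]%SET) = (o <= i <= o + ssize (shape_of b))%N.
  rewrite inE (perm_mem (perm_verts b)) mem_cat leb.
  have /negPf-> : inl i \notin inners b by apply/negP => /(inners_leaf lb).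
  rewrite orbF; apply/mapP/idP => [[j]|h].
    by rewrite mem_iota => h [->]; rewrite inordK; lia.
  by exists (i : nat); rewrite ?inord_val // mem_iota; lia.
rewrite /pair_sum /interval_sum; apply: eq_big => [i|i _]; first exact: mem.
by apply: eq_bigl => j; rewrite mem.
Qed.

Lemma X_edge_pair_sum t b p : planar_cubic t -> realizes t b -> p \in subs root b ->
  X_edge s t (edge_of p) = pair_sum [set i | inl i \in verts p.2]%SET.
Proof.
move=> pt rb pb; rewrite /X_edge; case: pickP => [r|/(_ p.1)]; last by rewrite !inE eqxx.
rewrite !inE => /orP[]/eqP->.
  by rewrite (edge_side_parent pt rb pb); apply: pair_sum_setC.
by rewrite (edge_side_top pt rb pb).
Qed.

Lemma prod_nodes_all (G : nat * nat -> R) l r o :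
  \prod_(o <= c < o + ssize (Bin l r)) G (ivl (Bin l r) o c) =
  G (o, ssize (Bin l r)) * ((\prod_(o <= c < o + ssize l) G (ivl l o c)) *
  \prod_((o + ssize l).+1 <= c < (o + ssize l).+1 + ssize r)
     G (ivl r (o + ssize l).+1 c)).
Proof.
rewrite -prod_nodes (bigD1_seq (o + ssize l)%N) ?iota_uniq ?ivl_root //.
by rewrite mem_index_iota /=; lia.
Qed.

Lemma leaves_node v l r o :
  leaves (LNode v l r) = leaf_seq o (ssize (shape_of (LNode v l r))).+1 ->
  leaves l = leaf_seq o (ssize (shape_of l)).+1 /\
  leaves r = leaf_seq (o + ssize (shape_of l)).+1 (ssize (shape_of r)).+1.
Proof.
rewrite /= /leaf_seq.
rewrite (_ : (_ + _).+2 = (ssize (shape_of l)).+1 + (ssize (shape_of r)).+1)%N; last by lia.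
rewrite iotaD map_cat addnS => /eqP; rewrite eqseq_cat ?size_leaves ?size_map ?size_iota //.
by case/andP => /eqP-> /eqP->.
Qed.

Lemma prod_subs (G : R -> R) u b o : leaf_inner b ->
  leaves b = leaf_seq o (ssize (shape_of b)).+1 -> (o + ssize (shape_of b) < N)%N ->
  \prod_(p <- subs u b | is_node p.2) G (pair_sum [set i | inl i \in verts p.2]%SET) =
  \prod_(o <= c < o + ssize (shape_of b))
    G (interval_sum (ivl (shape_of b) o c).1 (ivl (shape_of b) o c).2).
Proof.
elim: b u o => [v|v l IHl r IHr] u o lb leb lt.
  by rewrite big_cons big_nil /= addn0 big_geq.
rewrite [subs _ _]/= big_cons big_cat /=.
rewrite -[X in X * _ = _]/(G (pair_sum [set i | inl i \in verts (LNode v l r)]%SET)).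
rewrite (pair_sum_leaves lb leb lt).
have /and3P[_ hl hr] := lb.
have [ll lr] := leaves_node leb.
rewrite (IHl v o hl ll) ?(IHr v _ hr lr); [|move: lt => /=; lia..].
by rewrite (prod_nodes_all (fun q => G (interval_sum q.1 q.2))).
Qed.

(** The root of the shape is left out because the edge above it ends in the root leaf. [G] is the
    inverse for the amplitude and the identity for the nonvanishing of its denominators. *)
Lemma prod_edges (G : R -> R) t b : planar_cubic t -> realizes t b ->
  \prod_(e in interior_edges t) G (X_edge s t e) =
  \prod_(c < d.+1 | c != sroot (shape_of b) 0 :> nat)
    G (interval_sum (ivl (shape_of b) 0 c).1 (ivl (shape_of b) 0 c).2).
Proof.
move=> pt rb; rewrite (prod_interior_edges pt rb).
have [lb leb ub st] := rb.
have sz : ssize (shape_of b) = d.+1.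
  by have := size_leaves b; rewrite leb size_map size_iota => -[<-].
rewrite big_seq_cond.
rewrite (eq_bigr (fun p => G (pair_sum [set i | inl i \in verts p.2]%SET))); last first.
  by move=> p /andP[pb _]; rewrite (X_edge_pair_sum pt rb pb).
rewrite -big_seq_cond.
rewrite -(big_mkord (fun c => c != sroot (shape_of b) 0)
  (fun c => G (interval_sum (ivl (shape_of b) 0 c).1 (ivl (shape_of b) 0 c).2))).
rewrite -[X in index_iota 0 X]sz.
case: b lb leb sz {rb ub st} => [//|v l r] lb leb sz.
have /and3P[lv hl hr] := lb.
rewrite [subs _ _]/= big_cons /= big_cat /=.
have drop u b' : ~~ is_leaf u -> leaf_inner b' ->
    \prod_(p <- subs u b' | is_node p.2 && ~~ is_leaf p.1)
      G (pair_sum [set i | inl i \in verts p.2]%SET) =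
    \prod_(p <- subs u b' | is_node p.2)
      G (pair_sum [set i | inl i \in verts p.2]%SET).
  move=> lu lb'; rewrite big_seq_cond [RHS]big_seq_cond; apply: eq_bigl => p.
  by case pb : (p \in subs u b'); rewrite //= (subs_parent_inner lu lb' pb) andbT.
rewrite !drop //.
have [|ll lr] := @leaves_node v l r 0; first by rewrite leb -[in LHS]sz.
rewrite (prod_subs G v hl ll) ?(prod_subs G v hr lr); [|move: sz => /=; lia..].
by rewrite -(prod_nodes (fun q => G (interval_sum q.1 q.2)) (shape_of l) (shape_of r) 0).
Qed.

Lemma amplitude_shapes : amplitude s =
  \sum_(sh <- shapes d.+1) \prod_(c < d.+1 | c != sroot sh 0 :> nat)
    (interval_sum (ivl sh 0 c).1 (ivl sh 0 c).2)^-1.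
Proof.
pose has_shape sh (t : ptree N) : Prop :=
  planar_cubic t /\ exists2 b, realizes t b & shape_of b = sh.
pose cls sh : {set ptree N} := [set t | `[< has_shape sh t >]]%SET.
have clsP sh t : reflect (has_shape sh t) (t \in cls sh) by rewrite inE; apply: asboolP.
have mem_cls sh : ssize sh = d.+1 -> tree_of (label 0 sh) \in cls sh.
  move=> sz; apply/clsP; have [pt rb] := realizes_tree_of sz; split=> //.
  by exists (label 0 sh) => //; apply: shape_label.
have iso_cls t b : planar_cubic t -> realizes t b ->
    [set t' in [set t | `[< planar_cubic t >]] | isotopic t t']%SET = cls (shape_of b).
  move=> pt rb; apply/finset.setP => t'; apply/idP/clsP.
    rewrite !inE => /andP[/asboolP pt' iso]; split=> //.
    have [b' rb'] := planar_cubic_realizes pt'; exists b' => //.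
    by apply/esym/(isotopic_shape pt pt' rb rb').
  case=> pt' [b' rb' e]; rewrite !inE; apply/andP; split; first exact/asboolP.
  by apply/(isotopic_shape pt pt' rb rb').
rewrite /amplitude -big_enum.
have perm : perm_eq (enum (@PC N)) [seq cls sh | sh <- shapes d.+1].
  apply: uniq_perm; first exact: enum_uniq.
    rewrite map_inj_in_uniq ?shapes_uniq // => sh sh'.
    rewrite !mem_shapes => /eqP sz /eqP sz' e.
    have := mem_cls _ sz; rewrite e => /clsP[pt [b' rb' <-]].
    have [_ rb] := realizes_tree_of sz.
    by rewrite -(realizes_unique pt rb rb') shape_label.
  move=> C; rewrite mem_enum; apply/imsetP/mapP => [[t]|[sh]].
    rewrite inE => /asboolP pt ->; have [b rb] := planar_cubic_realizes pt.
    exists (shape_of b); last exact: iso_cls.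
    have [_ leb _ _] := rb; rewrite mem_shapes.
    by have := size_leaves b; rewrite leb size_map size_iota => -[<-].
  rewrite mem_shapes => /eqP sz ->; have [pt rb] := realizes_tree_of sz.
  exists (tree_of (label 0 sh)); first by rewrite inE; apply/asboolP.
  by rewrite (iso_cls _ _ pt rb) shape_label.
rewrite (perm_big _ perm) big_map; apply: eq_big_seq => sh.
rewrite mem_shapes => /eqP sz; case: pickP => [t /clsP[pt [b rb <-]]|/(_ (tree_of (label 0 sh)))].
  exact: (prod_edges (fun x => x^-1) pt rb).
by rewrite mem_cls.
Qed.

(** Every shape comes from a planar cubic tree, and these sums are the factors of its product of the
    X_e. *)
Lemma interval_sum_neq0 sh (c : 'I_d.+1) : amplitude_regular s -> ssize sh = d.+1 ->
  c != sroot sh 0 :> nat -> interval_sum (ivl sh 0 c).1 (ivl sh 0 c).2 != 0.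
Proof.
move=> reg sz cr; have [pt rb] := realizes_tree_of sz.
have := prod_edges id pt rb; rewrite shape_label => e.
have : \prod_(e in interior_edges (tree_of (label 0 sh)))
    X_edge s (tree_of (label 0 sh)) e != 0.
  by apply/prodf_neq0 => e' he; apply: reg.
by rewrite e => /prodf_neq0/(_ c cr).
Qed.

End Mandelstam.

End PlanarTrees.

Lemma denom_interval_sum (R : realType) (d : nat) (s : 'M[R]_d.+3) (t : shape) (c : 'I_d.+1) :
  ssize t = d.+1 ->
  dmv_denom (@Delta R d.+1) (subst_x s) 0 (row c (node_mx R d t)) =
  - interval_sum s (ivl t 0 c).1 (ivl t 0 c).2.
Proof.
move=> szt; rewrite denom_node_mx //; congr (- _).
have [_] : (0 <= (ivl t 0 c).1)%N /\ ((ivl t 0 c).1 + (ivl t 0 c).2 <= 0 + ssize t)%N.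
  by apply: ivl_range; rewrite /node szt /= ltn_ord.
rewrite add0n szt /interval_sum pair_big_dep /= /below.
case: (ivl t 0 c) => lo len /= le.
(* The nodes lo, ..., lo + len - 1 below [c] go with the leaves lo, ..., lo + len, and a pair i <= j
   of nodes with the pair i < j + 1 of leaves, as in the substitution. *)
rewrite [RHS](reindex_omap
  (fun p : index_pair d.+1 => (inord (val p).1, inord (val p).2.+1) : 'I_d.+3 * 'I_d.+3)
  (fun ij => insub (inord ij.1, inord ij.2.-1))) /=; last first.
  case=> i j /= h; have hi : (i < d.+1)%N by lia.
  have hj : (j.-1 < d.+1)%N by lia.
  rewrite insubT /=; first by rewrite !inordK //; lia.
  move=> h'; congr (Some (_, _)); apply: val_inj; rewrite /= !inordK //; lia.
apply: eq_big => [[[i j] /= ij]|//].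
have hi := ltn_ord i; have hj := ltn_ord j.
rewrite !inordK; [|lia..].
rewrite (_ : insub _ == Some _ = true) ?andbT; first by apply/idP/idP; lia.
have -> : (inord i, inord j.+1.-1) = (i, j) :> 'I_d.+1 * 'I_d.+1 by rewrite /= !inord_val.
by rewrite insubT; apply/eqP; congr Some; apply: val_inj.
Qed.

Theorem proposition14p10 (R : realType) (n : nat) (n_ge1 : (1 <= n)%N) :
  exists2 eps : R, (eps = 1 \/ eps = -1) &
    forall (m : nat) (T : 'I_m -> n.-1.-tuple 'rV[R]_n) (s : 'M[R]_n.+2),
      dmv_triangulation (@Delta R n) T ->
      mandelstam s ->
      dmv_regular (@Delta R n) T (subst_x s) 0 ->
      amplitude_regular s ->
      dual_mixed_volume (@Delta R n) T (subst_x s) 0 = eps * amplitude s.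
Proof.
(* A binary tree with d + 1 nodes has d proper subtrees, and each gives one factor -1. *)
case: n n_ge1 => // d _; exists ((-1) ^+ d).
  by rewrite -signr_odd; case: odd; [right|left].
move=> m T s triT ms regT regA.
rewrite (@dual_mixed_volume_trees R d (subst_x s) (sum_subst_x ms) m T triT regT); last first.
  by move=> t c szt cr; rewrite denom_interval_sum // oppr_eq0 interval_sum_neq0.
rewrite amplitude_shapes // mulr_sumr; apply: eq_big_seq => t.
rewrite mem_shapes => /eqP szt.
under eq_bigr do rewrite denom_interval_sum // invrN.
rewrite prodrN; congr (_ ^+ _ * _).
have rn : (sroot t 0 < d.+1)%N.
  have : node t 0 (sroot t 0) by apply: (@node_sroot _ _ 0); rewrite /node szt.
  by rewrite /node szt.
transitivity #|predC1 (Ordinal rn)|; first exact: eq_card.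
by rewrite cardC1 card_ord.
Qed.
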